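(* Let $(X,d)$ be a complete metric space and $(a,b)\subseteq\mathbb{R}$ a bounded open interval. Let $f,f_n \in AC^1((a,b),X)$, $n\ge 1$, be such that $|f_n'| \to |f'|$ in $L^1((a,b))$. Fix $\epsilon>0$ and let $\hat f := f \circ t$ and $\hat f_n := f_n \circ t_n$, where $t := t_{\epsilon,f}$ and $t_n := t_{\epsilon,f_n}$ are the reparameterizations defined in the context. Then $t_n \to t$ in $W^{1,q}_{\mathrm{loc}}(\mathbb{R})$ and $|\hat f_n'| \to |\hat f'|$ in $L^q_{\mathrm{loc}}(\mathbb{R})$, for all $q \in[1,\infty)$.
   Context: $AC^1((a,b),X)$ is the set of maps $f : (a,b) \to X$ for which there is $m \in L^1((a,b))$ with $d(f(x),f(y)) \le \int_x^y m(u)\,du$ whenever $a<x\le y<b$. Such $f$ is uniformly continuous and is extended continuously to $[a,b]$. Its metric slope (metric derivative) $|f'|(x) := \lim_{y \to x} \frac{d(f(x),f(y))}{|x-y|}$ exists for almost every $x\in(a,b)$ and belongs to $L^1((a,b))$. The same definition of metric slope is used for Lipschitz curves $\mathbb{R}\to X$ such as $\hat f,\hat f_n$. Reparameterization: for $\epsilon>0$ and $f \in AC^1((a,b),X)$ let $s_{\epsilon,f}(x) := \int_a^x (\epsilon + |f'|(u))\,du$ for $x \in [a,b]$ and $L := s_{\epsilon,f}(b)$. Then $s_{\epsilon,f} : [a,b]\to[0,L]$ is a strictly increasing bijection; $t_{\epsilon,f} : \mathbb{R} \to [a,b]$ is defined as $s_{\epsilon,f}^{-1}$ on $[0,L]$,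 as $a$ on $(-\infty,0)$, and as $b$ on $(L,\infty)$. The map $t_{\epsilon,f}$ is $\frac1\epsilon$-Lipschitz and $f\circ t_{\epsilon,f}$ is $1$-Lipschitz. Convergence in $W^{1,q}_{\mathrm{loc}}(\mathbb{R})$ (resp. $L^q_{\mathrm{loc}}(\mathbb{R})$) means convergence in $W^{1,q}$ (resp. $L^q$) on every bounded open interval. *)

(* Defs.v *)
From HB Require Import structures.
From mathcomp Require Import all_boot all_order all_algebra.
From mathcomp Require Import all_classical all_reals all_analysis.
Set Implicit Arguments.
Unset Strict Implicit.
Unset Printing Implicit Defensive.
Import Order.TTheory GRing.Theory Num.Theory.
Import numFieldNormedType.Exports.
Local Open Scope classical_set_scope.
Local Open Scope ring_scope.

(* The condition of [completeType]; that structure assumes a distinguished point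
   and has no join with [metricType] in the library. *)
Definition is_complete (T : uniformType) : Prop :=
  forall F : set_system T, ProperFilter F -> cauchy F -> exists l : T, F --> l.

Section Lq.
Context {R : realType}.
Implicit Types (D : set R) (q : R) (g u phi : R -> R).
Notation mu := (@lebesgue_measure R).

(* [g \_ D] is [g] on [D] and [0] elsewhere. *)
Definition Lq_norm D q g : \bar R := 'N[mu]_(q%:E)[EFin \o (g \_ D)]%E.

Definition in_Lq D q g : Prop := measurable_fun D g /\ (Lq_norm D q g < +oo)%E.

Definition Lq_cvg D q (gn : nat -> R -> R) g : Prop :=
  [/\ forall n, in_Lq D q (gn n), in_Lq D q g &
      Lq_norm D q (gn n \- g) @[n --> \oo] --> 0%E].

(* The space C_c^oo(D); elements are extended by [0] outside [D]. *)
Definition test_function D phi : Prop :=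
  let supp := closure [set x | phi x != 0] in
  [/\ forall n x, derivable (derive1n n phi) x 1, compact supp & supp `<=` D].

Definition weak_derivative D u g : Prop :=
  [/\ locally_integrable D u, locally_integrable D g &
      forall phi, test_function D phi ->
        \int[mu]_(x in D) (u x * derive1 phi x) = - \int[mu]_(x in D) (g x * phi x)].

(* Weak derivatives are unique almost everywhere, so that it does not matter
   which representatives [vn] and [v] are chosen. *)
Definition W1q_cvg D q (un : nat -> R -> R) u : Prop :=
  exists (vn : nat -> R -> R) (v : R -> R),
    [/\ forall n, weak_derivative D (un n) (vn n), weak_derivative D u v,
        Lq_cvg D q un u & Lq_cvg D q vn v].

Definition Lq_loc_cvg q (gn : nat -> R -> R) g : Prop :=
  forall c d : R, c < d -> Lq_cvg `]c, d[ q gn g.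

Definition W1q_loc_cvg q (un : nat -> R -> R) u : Prop :=
  forall c d : R, c < d -> W1q_cvg `]c, d[ q un u.

End Lq.

(* A curve on (a,b) is represented by a total function [f : R -> X] of which
   only the values on ]a, b[ are used. *)
Section Curves.
Context {R : realType} {X : metricType R}.
Implicit Types (a b eps : R) (f : R -> X).
Notation mu := (@lebesgue_measure R).

Definition AC1 a b f : Prop :=
  exists2 m : R -> R, mu.-integrable `]a, b[ (EFin \o m) &
    forall x y, a < x -> x <= y -> y < b ->
      mdist (f x) (f y) <= \int[mu]_(u in `[x, y]) m u.

(* [lim] takes a constant value at the points where the limit does not exist. *)
Definition metric_slope f (x : R) : R :=
  lim (mdist (f x) (f y) / `|x - y| @[y --> x^']).

(* The continuous extension to [a, b] of [f] on ]a, b[; the value [f x] given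
   to [xget] is used only when the one-sided limit does not exist. *)
Definition cont_ext a b f (x : R) : X :=
  if x <= a then xget (f x) [set l | f y @[y --> a^'+] --> l]
  else if b <= x then xget (f x) [set l | f y @[y --> b^'-] --> l]
  else f x.

Definition arc_s a b eps f (x : R) : R :=
  \int[mu]_(u in `]a, x[) (eps + metric_slope f u).

Definition arc_t a b eps f (y : R) : R :=
  if y < 0 then a
  else if arc_s a b eps f b < y then b
  else 'pinv_(fun=> a) `[a, b] (arc_s a b eps f) y.

Definition reparam a b eps f : R -> X := cont_ext a b f \o arc_t a b eps f.

End Curves.

(* Main.v *)
Require Import Defs.
From HB Require Import structures.
From mathcomp Require Import all_boot all_order all_algebra.
From mathcomp Require Import all_classical all_reals all_analysis.
From mathcomp Require Import measurable_realfun ring lra.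
Set Implicit Arguments.
Unset Strict Implicit.
Unset Printing Implicit Defensive.
Import Order.TTheory GRing.Theory Num.Theory.
Import numFieldNormedType.Exports.
Local Open Scope classical_set_scope.
Local Open Scope ring_scope.

(** Let [g] be the metric slope of [f] on ]a, b[, extended by [0], let [s] be the
    arc length with density [eps + g], and let [L = s b]. Everything about [t]
    follows from three facts: [t] takes values in [a, b], [s (t y)] is [y]
    clamped to [0, L], and [s] grows at rate at least [eps].

    The change of variables behind the proof is that [t] pushes Lebesgue measure
    on ]0, L] to the measure of density [eps + g] on ]a, b]
    ([lebesgue_measure_inv_arclength]). In particular [t] is a primitive of
    [k = 1 / (eps + g o t)] on ]0, L], continued by [0] ([integral_inv_speed]),
    and a Lipschitz primitive of a bounded function has it as weak derivative
    ([lipschitz_primitive_weak_derivative]).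

    Let [g_n] converge to [g] in L^1. Then [s_n] converges to [s] uniformly, hence
    so does [t_n] to [t] ([inv_arclength_dist]). To compare [k_n] with [k] in L^1,
    although [g_n o t_n] need not converge pointwise, choose a continuous [c] that
    is L^1-close to [k]. By the change of variables the distance from [k_n] to [c]
    on ]0, L_n] is
      [int_a^b |1 - c (s_n x) (eps + g_n x)| dx],
    in which the composition with [t_n] has disappeared. As [n] grows this tends
    to the same expression for [s] and [g], which is the distance from [k] to [c]
    ([inv_speed_defect_le], [cvg_inv_speed]). All the functions involved are
    uniformly bounded, so that L^1 convergence gives L^q convergence on bounded
    intervals ([Lq_cvg_bounded]). This is the first claim.

    For the second claim, the chain rule for slopes ([metric_slope_comp]) shows
    that the slope of the reparametrized curve is [g (t y) / (eps + g (t y))] for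
    almost every [y] in ]0, L[, that is [1 - eps * k y], and it is [0] outside
    [0, L] ([ae_metric_slope_reparam]). Convergence of these slopes is therefore
    convergence of [k_n] together with that of the indicators of ]0, L_n]. What
    remains is that the slope is a Borel function ([measurable_metric_slope]). *)

(** * Integration against a measure given by a density *)

Section density.
Context d (T : measurableType d) (R : realType).
Variables (mu nu : {measure set T -> \bar R}) (h : T -> R).
Hypotheses (mh : measurable_fun [set: T] h) (h0 : forall x, 0 <= h x).
Hypothesis nuE : forall A, measurable A ->
  nu A = (\int[mu]_(x in A) (h x)%:E)%E.
Local Open Scope ereal_scope.
Import HBNNSimple.

Lemma integral_nnsfun_density (F : {nnsfun T >-> R}) :
  \int[nu]_x (F x)%:E = \int[mu]_x ((F x)%:E * (h x)%:E).
Proof.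
have mEh : measurable_fun [set: T] (fun x => (h x)%:E) by exact/measurable_EFinP.
have mk k : measurable_fun [set: T]
    (fun x => (k * \1_(F @^-1` [set k]) x)%:E).
  by apply/measurable_EFinP; exact: measurable_funM.
rewrite integralT_nnsfun sintegralE.
under [RHS]eq_integral => x _.
  rewrite fimfunE -fsumEFin// ge0_mule_fsuml; last first.
    by move=> k; exact: nnfun_muleindic_ge0.
  over.
rewrite ge0_integral_fsum//; last 2 first.
- by move=> k; exact: emeasurable_funM.
- move=> k x _; apply: mule_ge0; last by rewrite lee_fin.
  exact: nnfun_muleindic_ge0.
apply: eq_fsbigr => k; rewrite inE => -[x0 _ x0k].
have k0 : (0 <= k)%R by rewrite -x0k.
rewrite nuE// -ge0_integralZl//; last 2 first.
- exact: measurable_funTS.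
- by move=> x _; rewrite lee_fin.
rewrite integral_mkcond; apply: eq_integral => x _.
by rewrite patchE indicE; case: ifPn => _; rewrite ?mulr1 ?mulr0 ?mul0e.
Qed.

(** Both sides are continuous along increasing sequences, so that the simple
    functions of [integral_nnsfun_density] suffice. *)
Lemma ge0_integral_density (F : T -> \bar R) :
  measurable_fun [set: T] F -> (forall x, 0 <= F x) ->
  \int[nu]_x F x = \int[mu]_x (F x * (h x)%:E).
Proof.
move=> mF F0; pose F_ := nnsfun_approx measurableT mF.
have F_cvg x : (F_ n x)%:E @[n --> \oo] --> F x.
  by apply: cvg_nnsfun_approx.
transitivity (limn (fun n => \int[nu]_x (F_ n x)%:E)).
  rewrite -monotone_convergence//.
  - by apply: eq_integral => x _; apply/esym/cvg_lim.
  - by move=> n; exact/measurable_EFinP.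
  - by move=> n x _; rewrite lee_fin.
  - by move=> x _ m n mn; rewrite lee_fin; exact/lefP/nd_nnsfun_approx.
under [X in limn X]eq_fun do rewrite integral_nnsfun_density.
rewrite -monotone_convergence//.
- by apply: eq_integral => x _; apply/cvg_lim => //; exact: cvgeZr.
- by move=> n; apply: emeasurable_funM; exact/measurable_EFinP.
- by move=> n x _; rewrite mule_ge0// lee_fin.
- move=> x _ m n mn; rewrite lee_wpmul2r ?lee_fin//.
  exact/lefP/nd_nnsfun_approx.
Qed.

End density.

(** * Arc length and its inverse *)

Lemma measurable_invr_gt0 {R : realType} (f : R -> R) : (forall x, 0 < f x) ->
  measurable_fun [set: R] f -> measurable_fun [set: R] (fun x => (f x)^-1).
Proof.
move=> f0 mf; under eq_fun do rewrite -powR_inv1 ?ltW//.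
exact: measurableT_comp (measurable_powR _) mf.
Qed.

Section arclength.
Context {R : realType}.
Notation mu := (@lebesgue_measure R).

(** The reparametrization depends on the curve only through its slope; the theory
    of [arclength] is therefore that of a nonnegative integrable function [g]. *)
Definition arclength (a eps : R) (g : R -> R) x :=
  \int[mu]_(u in `]a, x[) (eps + g u).

Definition is_speed (a b eps : R) (g : R -> R) : Prop :=
  [/\ a < b, 0 < eps, mu.-integrable [set: R] (EFin \o g) &
      forall x, 0 <= g x].

Variables (a b eps : R) (g : R -> R).
Hypothesis gP : is_speed a b eps g.
Let h x := eps + g x.
Let s := arclength a eps g.
Let L := s b.

Let ab : a < b. Proof. by case: gP. Qed.
Let eps0 : 0 < eps. Proof. by case: gP. Qed.
Let ig : mu.-integrable [set: R] (EFin \o g). Proof. by case: gP. Qed.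
Let g0 x : 0 <= g x. Proof. by case: gP. Qed.

Let mg : measurable_fun [set: R] g.
Proof. by apply/measurable_EFinP; exact: measurable_int ig. Qed.

Lemma measurable_speed : measurable_fun [set: R] h.
Proof. exact: measurable_funD. Qed.
Let mh := measurable_speed.

Lemma speed_ge x : eps <= h x. Proof. by rewrite lerDl. Qed.
Lemma speed_gt0 x : 0 < h x. Proof. exact: lt_le_trans (speed_ge x). Qed.
Lemma speed_ge0 x : 0 <= h x. Proof. exact/ltW/speed_gt0. Qed.
Let h_ge := speed_ge.
Let h_ge0 := speed_ge0.

Lemma integrable_speed (D : set R) : measurable D -> (mu D < +oo)%E ->
  mu.-integrable D (EFin \o h).
Proof.
move=> mD Dfin.
rewrite (_ : EFin \o h = (EFin \o cst eps) \+ (EFin \o g))%E//.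
apply: integrableD => //; last exact: integrableS ig.
apply: measurable_bounded_integrable => //.
by exists `|eps|; split => // M ltM x _ /=; exact: ltW.
Qed.

Lemma integrable_speed_itv (b1 b2 : bool) x y :
  mu.-integrable [set` Interval (BSide b1 x) (BSide b2 y)] (EFin \o h).
Proof.
apply: integrable_speed => //; rewrite lebesgue_measure_itv/=.
by case: ifP => // _; rewrite -EFinB ltry.
Qed.

Lemma arclengthB x y : a <= x -> x <= y ->
  s y - s x = \int[mu]_(u in `]x, y]) h u.
Proof.
move=> ax xy.
rewrite /s /arclength !Rintegral_itv_bndo_bndc//; [|exact: integrable_speed_itv..].
by rewrite Rintegral_itvB//; exact: integrable_speed_itv.
Qed.

Lemma integral_speed x y : a <= x -> x <= y ->
  (\int[mu]_(u in `]x, y]) (h u)%:E = (s y - s x)%:E)%E.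
Proof.
move=> ax xy; rewrite arclengthB// /Rintegral fineK//.
by apply: integrable_fin_num => //; exact: integrable_speed_itv.
Qed.

Lemma arclength_ge x y : a <= x -> x <= y -> eps * (y - x) <= s y - s x.
Proof.
move=> ax xy; rewrite -lee_fin -integral_speed//.
apply: (@le_trans _ _ (\int[mu]_(u in `]x, y]) (cst eps%:E u))%E).
  rewrite integral_cst//= lebesgue_measure_itv/= lte_fin.
  by case: ifPn => [_|]; rewrite ?EFinM ?EFinB// -leNgt => yx;
    rewrite mule0 lee_fin mulr_ge0_le0 ?subr_le0// ltW.
apply: ge0_le_integral => //= [u _| |u _].
- by rewrite lee_fin ltW.
- by apply/measurable_EFinP; exact: measurable_funTS.
- by rewrite lee_fin h_ge.
Qed.

Lemma arclength_a : s a = 0.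
Proof. by rewrite /s /arclength set_itv_ge ?bnd_simp// Rintegral_set0. Qed.

Lemma ltr_arclength x y : a <= x -> a <= y -> (s x < s y) = (x < y).
Proof.
move=> ax ay; apply/idP/idP => [|xy]; last first.
  have := arclength_ge ax (ltW xy); rewrite -subr_gt0; apply: lt_le_trans.
  by rewrite mulr_gt0// subr_gt0.
rewrite !ltNge; apply: contra => yx; rewrite -subr_ge0.
by apply: le_trans (arclength_ge ay yx); rewrite mulr_ge0 ?subr_ge0// ltW.
Qed.

Lemma ler_arclength x y : a <= x -> a <= y -> (s x <= s y) = (x <= y).
Proof. by move=> ax ay; rewrite !leNgt ltr_arclength. Qed.

Lemma arclength_ge0 x : a <= x -> 0 <= s x.
Proof. by move=> ax; rewrite -arclength_a ler_arclength. Qed.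

Lemma arclength_b_gt0 : 0 < L.
Proof. by rewrite -arclength_a ltr_arclength// ltW. Qed.

Lemma locally_integrable_speed : locally_integrable [set: R] h.
Proof.
split => //; first exact: openT.
move=> K _ cK; have mK := compact_measurable cK.
have := integrable_speed mK (compact_finite_measure cK).
by case/integrableP.
Qed.

(** The Lebesgue points of the speed form a set of full measure, and at each of
    them the fundamental theorem of calculus applies. *)
Lemma is_derive_arclength x : a < x -> lebesgue_pt h x ->
  is_derive x (1 : R) s (h x).
Proof.
move=> ax hx.
have sE : s = fun y => \int[mu]_(u in `]a, y]) h u.
  by apply/funext => y; rewrite /s /arclength Rintegral_itv_bndo_bndc//;
    exact: integrable_speed_itv.
have xx1 : x < x + 1 by rewrite ltrDl.
have [] := @FTC1_lebesgue_pt _ h (BRight a) x _ xx1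
  (integrable_speed_itv _ _ _ _) ax hx.
by rewrite -sE derive1E => /derivableP sx <-.
Qed.

End arclength.

Section arclength_surjective.
Context {R : realType}.
Notation mu := (@lebesgue_measure R).
Variables (a b eps : R) (g : R -> R).
Hypothesis gP : is_speed a b eps g.
Let s := arclength a eps g.

Lemma within_continuous_arclength : {within `[a, b], continuous s}.
Proof.
have [ab _ _ _] := gP.
have -> : s = fun x => \int[mu]_(u in `[a, x]) (eps + g u).
  apply/funext => x; rewrite /s /arclength.
  rewrite Rintegral_itv_bndo_bndc; last exact: integrable_speed_itv gP _ _ _ _.
  by rewrite Rintegral_itv_obnd_cbnd//; exact: integrable_speed_itv gP _ _ _ _.
apply: parameterized_integral_continuous; first exact: ltW.
exact: integrable_speed_itv gP _ _ _ _.
Qed.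

Lemma arclength_surj : set_surj `[a, b] `[0, s b] s.
Proof.
move=> y /=; rewrite in_itv/= => /andP[y0 yL].
have [ab _ _ _] := gP.
have [|x xab <-] := @IVT _ s a b y (ltW ab) within_continuous_arclength.
  by rewrite /s arclength_a ge_min y0 le_max yL orbT.
by exists x.
Qed.

End arclength_surjective.

Section inv_arclength.
Context {R : realType}.
Notation mu := (@lebesgue_measure R).

(** Clamping [y] to [0, L], rather than asking for an inverse on [0, L] only,
    determines [t] on the whole line by one equation, valid also where [t] is
    constant. *)
Definition is_inv_arclength (a b eps : R) (g t : R -> R) : Prop :=
  [/\ is_speed a b eps g, forall y, a <= t y <= b &
      forall y, arclength a eps g (t y) =
        Num.max 0 (Num.min y (arclength a eps g b))].

Variables (a b eps : R) (g t : R -> R).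
Hypothesis tP : is_inv_arclength a b eps g t.
Let h x := eps + g x.
Let s := arclength a eps g.
Let L := s b.

Let gP : is_speed a b eps g. Proof. by case: tP. Qed.
Let ab : a < b. Proof. by case: gP. Qed.
Let eps0 : 0 < eps. Proof. by case: gP. Qed.
Let mh : measurable_fun [set: R] h. Proof. exact: measurable_speed gP. Qed.
Let h_ge x : eps <= h x. Proof. exact: speed_ge gP x. Qed.
Let h_gt0 x : 0 < h x. Proof. exact: speed_gt0 gP x. Qed.
Let h_ge0 x : 0 <= h x. Proof. exact: speed_ge0 gP x. Qed.
Let st y : s (t y) = Num.max 0 (Num.min y L). Proof. by case: tP. Qed.
Let t_in y : a <= t y <= b. Proof. by case: tP. Qed.
Let tax y : a <= t y. Proof. by case/andP: (t_in y). Qed.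
Let txb y : t y <= b. Proof. by case/andP: (t_in y). Qed.

Let ler_s x y : a <= x -> a <= y -> (s x <= s y) = (x <= y).
Proof. exact: (ler_arclength gP). Qed.
Let ltr_s x y : a <= x -> a <= y -> (s x < s y) = (x < y).
Proof. exact: (ltr_arclength gP). Qed.
Let s_ge x y : a <= x -> x <= y -> eps * (y - x) <= s y - s x.
Proof. exact: (arclength_ge gP). Qed.
Let s_a : s a = 0. Proof. exact: arclength_a. Qed.
Let s_ge0 x : a <= x -> 0 <= s x. Proof. exact: (arclength_ge0 gP). Qed.

Lemma arclength_inv_in y : 0 <= y <= L -> s (t y) = y.
Proof.
by move=> /andP[y0 yL]; rewrite st (min_idPl yL) (max_idPr y0).
Qed.

Lemma arclengthK x : a <= x <= b -> t (s x) = x.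
Proof.
move=> /andP[ax xb]; apply/eqP; rewrite eq_le.
rewrite -(ler_s (tax _) ax) -(ler_s ax (tax _)).
by rewrite arclength_inv_in ?lexx// s_ge0//= ler_s// ltW.
Qed.

Lemma nondecreasing_inv_arclength : {homo t : y z / y <= z}.
Proof.
move=> z y zy.
by rewrite -(ler_s (tax _) (tax _)) !st ge_max le_max lexx/=
    le_max le_min !ge_min zy lexx/= !orbT.
Qed.

Lemma inv_arclength_lip y z : `|t y - t z| <= eps^-1 * `|y - z|.
Proof.
wlog zy : y z / z <= y => [hw|].
  by case/orP: (le_total z y) => /hw//; rewrite distrC (distrC z).
have tzy := nondecreasing_inv_arclength zy.
rewrite !ger0_norm ?subr_ge0// ler_pdivlMl//.
apply: le_trans (s_ge (tax _) tzy) _; rewrite !st.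
by rewrite /Num.max /Num.min; do ! case: ifPn; rewrite -?leNgt => *; lra.
Qed.

Lemma continuous_inv_arclength : continuous t.
Proof.
move=> y; apply/cvgrPdist_le => /= e e0; near=> z.
apply: le_trans (inv_arclength_lip _ _) _.
rewrite ler_pdivrMl//; near: z.
apply: cvgr_dist_le; last by rewrite mulr_gt0.
exact: cvg_id.
Unshelve. all: by end_near. Qed.

Lemma measurable_inv_arclength : measurable_fun [set: R] t.
Proof. exact: continuous_measurable_fun continuous_inv_arclength. Qed.

(* [s] inverts [t] on [a, b] only; through [cl] the condition [x < t y] is
   expressed by [s] for every real [x]. *)
Let cl x := Num.max a (Num.min x b).
Let acl x : a <= cl x. Proof. by rewrite le_max lexx. Qed.
Let clb x : cl x <= b. Proof. by rewrite ge_max ge_min lexx orbT andbT ltW. Qed.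

Lemma inv_arclength_gt x y : 0 < y -> y <= L -> (x < t y) = (s (cl x) < y).
Proof.
move=> y0 yL; rewrite -{2}(@arclength_inv_in y) ?yL ?(ltW y0)//.
rewrite ltr_s// gt_max gt_min (ltNge b) txb orbF.
rewrite (_ : a < t y = true) //.
by rewrite -ltr_s// s_a arclength_inv_in ?(ltW y0).
Qed.

Notation D := (`]a, b]%classic : set R).
Let hD x : R := h x * \1_D x.
Let nu_ A := (\int[mu]_(x in A) (hD x)%:E)%E.

Let mhD : measurable_fun [set: R] hD.
Proof. by apply: measurable_funM => //; exact: measurable_indic. Qed.

Let hD_ge0 x : 0 <= hD x. Proof. by rewrite mulr_ge0. Qed.

Lemma integral_speed_indic A : measurable A ->
  nu_ A = (\int[mu]_(x in A `&` D) (h x)%:E)%E.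
Proof.
move=> mA; rewrite [RHS]integral_mkcondr; apply: eq_integral => x _.
by rewrite /hD patchE indicE; case: ifPn => _; rewrite ?mulr1 ?mulr0.
Qed.

(** The image of Lebesgue measure under [t] has density [h] on ]a, b]. Two
    finite measures are compared on the intervals ]p, q]: since
    [p < t y] means [s (cl p) < y], the preimage of ]p, q] in ]0, L] is exactly
    ](s (cl p)), (s (cl q))], whose length is the integral of [h]. *)
Lemma lebesgue_measure_inv_arclength A : measurable A ->
  mu (t @^-1` A `&` `]0, L]) = (\int[mu]_(x in A `&` D) (h x)%:E)%E.
Proof.
have nu0 : nu_ set0 = 0%E by rewrite /nu_ integral_set0.
have nu_ge0 B : (0 <= nu_ B)%E.
  by apply: integral_ge0 => x _; rewrite lee_fin.
have nusa : semi_sigma_additive nu_.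
  apply: semi_sigma_additive_nng_induced; first exact/measurable_EFinP.
  by move=> x; rewrite lee_fin.
pose nu : {measure set (measurableTypeR R) -> \bar R} :=
  HB.pack nu_ (isMeasure.Build _ _ _ nu_ nu0 nu_ge0 nusa).
have mL : measurable (`]0, L]%classic : set R) by [].
have mt : measurable_fun [set: measurableTypeR R]
  (t : measurableTypeR R -> measurableTypeR R) := measurable_inv_arclength.
have [nu' nuE] : exists nu' : {measure set (measurableTypeR R) -> \bar R},
    forall B, nu' B = mu (t @^-1` B `&` `]0, L]%classic).
  by exists (pushforward (mrestr mu mL)
               (t : measurableTypeR R -> measurableTypeR R)).
move=> mA; rewrite -integral_speed_indic// -nuE -[RHS]/(nu A).
apply: (@measure_unique _ _ (measurableTypeR R) (@ocitv R)
  (fun n => `](- n%:R), n%:R]%classic) _ _ _ _ nu' nu) => //.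
- exact: ocitvI.
- by move=> n; exists (- n%:R, n%:R).
- rewrite -subTset => /= x _; exists (Num.bound `|x|) => //=.
  have := archi_boundP (normr_ge0 x); rewrite in_itv/= ltr_norml.
  by move=> /andP[-> /ltW].
- move=> _ [[p q] _ <-] /=; rewrite nuE -[RHS]/(nu_ _) integral_speed_indic//.
  have [pq|qp] := leP p q; last first.
    by rewrite set_itv_ge -?leNgt ?bnd_simp ?(ltW qp)// preimage_set0 !set0I
      measure0 integral_set0.
  have clpq : cl p <= cl q.
    rewrite /cl /Num.max /Num.min.
    by do ! case: ifPn; rewrite -?leNgt => *; lra.
  rewrite (_ : `]p, q] `&` D = `](cl p), (cl q)]%classic); last first.
    apply/seteqP; split => x /=; rewrite !in_itv/= gt_max le_max gt_min le_min.
      by move=> [/andP[-> ->] /andP[-> ->]]; rewrite orbT.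
    move=> /andP[/andP[ax px]]; rewrite [x <= a]leNgt ax/= => /andP[xq xb].
    by move: px; rewrite [b < x]ltNge xb orbF => ->.
  rewrite (integral_speed gP)// -/s.
  rewrite (_ : _ `&` _ = `](s (cl p)), (s (cl q))]%classic); last first.
    apply/seteqP; split => y /=; rewrite !in_itv/=.
      move=> [/andP[py yq] /andP[y0 yL]].
      by rewrite -inv_arclength_gt// py leNgt -inv_arclength_gt// -leNgt.
    move=> /andP[py yq].
    have y0 : 0 < y by apply: le_lt_trans py; exact: s_ge0.
    have yL : y <= L by apply: le_trans yq _; rewrite ler_s// ltW.
    by rewrite y0 yL inv_arclength_gt// py leNgt inv_arclength_gt// -leNgt.
  rewrite lebesgue_measure_itv/= lte_fin ltr_s//.
  case: ifPn => //; rewrite -leNgt => qp.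
  by rewrite (le_anti (introT andP (conj clpq qp))) subrr.
- move=> n; rewrite nuE; apply: (@le_lt_trans _ _ (mu `]0, L])).
    apply: le_measure; rewrite ?inE//.
    by apply: measurableI => //; rewrite -[X in measurable X]setTI; exact: mt.
  rewrite lebesgue_measure_itv/=; case: ifP => // _.
  by rewrite -EFinB ltry.
Unshelve. exact: mt.
Qed.

(** The substitution [y = s x]. As [h] is only measurable, the substitution
    rule for continuously differentiable maps does not apply; the identity is read
    off from the image measure of [t]. *)
Lemma ge0_integral_inv_arclength (F : R -> \bar R) :
  measurable_fun [set: R] F -> (forall x, 0 <= F x)%E ->
  (\int[mu]_(y in `]0%R, L]) F (t y) = \int[mu]_(x in D) (F x * (h x)%:E))%E.
Proof.
move=> mF F0.
have mFt : measurable_fun [set: R] (F \o t).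
  exact: measurableT_comp mF measurable_inv_arclength.
have mL : measurable (`]0, L]%classic : set R) by [].
have mt : measurable_fun [set: measurableTypeR R]
  (t : measurableTypeR R -> measurableTypeR R) := measurable_inv_arclength.
have [nu' [nuE nuI]] : exists nu' : {measure set (measurableTypeR R) -> \bar R},
    (forall B, nu' B = mu (t @^-1` B `&` `]0, L]%classic)) /\
    (\int[nu']_x F x = \int[mrestr mu mL]_y F (t y))%E.
  exists (pushforward (mrestr mu mL)
               (t : measurableTypeR R -> measurableTypeR R)).
  split; first by move=> B.
  by rewrite [LHS](ge0_integral_pushforward mt).
transitivity (\int[mrestr mu mL]_y F (t y))%E.
  rewrite (@ge0_integral_density _ _ _ mu _ (\1_`]0, L])).
  - rewrite [LHS]integral_mkcond.
    apply: eq_integral => y _.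
    by rewrite patchE indicE; case: ifPn => _; rewrite ?mule1 ?mule0.
  - exact: measurable_indic.
  - by [].
  - by move=> A mA; rewrite integral_indic// setIC.
  - exact: mFt.
  - by move=> y; exact: F0.
rewrite -nuI (@ge0_integral_density _ _ _ mu _ hD)//.
- rewrite [RHS]integral_mkcond; apply: eq_integral => x _.
  by rewrite patchE /hD indicE; case: ifPn => _; rewrite ?mulr1 ?mulr0 ?mule0.
- move=> A mA; rewrite nuE lebesgue_measure_inv_arclength//.
  by rewrite -integral_speed_indic.
Unshelve. exact: mt.
Qed.

Lemma inv_arclength_lt y z : 0 < z -> z <= L -> (t y < t z) = (y < z).
Proof.
move=> z0 zL; rewrite -(ltr_s (tax _) (tax _)).
rewrite [s (t z)]arclength_inv_in ?(ltW z0)// st gt_max z0/= gt_min.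
by rewrite [L < z]ltNge zL orbF.
Qed.

(** The derivative of [t] almost everywhere: the inverse of the speed on ]0, L],
    and [0] where [t] is constant. *)
Definition inv_speed y : R := (eps + g (t y))^-1 * \1_(`]0, L]) y.
Let k := inv_speed.

Lemma measurable_inv_speed : measurable_fun [set: R] k.
Proof.
apply: measurable_funM; last exact: measurable_indic.
apply: measurable_invr_gt0 => [x|]; first exact: h_gt0.
exact: measurableT_comp mh measurable_inv_arclength.
Qed.

Lemma inv_speed_ge0 y : 0 <= k y.
Proof. by rewrite mulr_ge0// invr_ge0; exact: h_ge0. Qed.

Lemma inv_speed_le y : k y <= eps^-1.
Proof.
rewrite -[leRHS]mulr1 ler_pM//.
- by rewrite invr_ge0; exact: h_ge0.
- by rewrite lef_pV2//; [exact: h_ge|exact: h_gt0].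
Qed.

(** By the change of variables the left-hand side becomes the integral over
    ](t y), (t z)] of [h^-1 * h = 1]. *)
Lemma integral_inv_speed y z : y <= z ->
  (\int[mu]_(u in `]y, z]) (k u)%:E = (t z - t y)%:E)%E.
Proof.
move=> yz; have tyz := nondecreasing_inv_arclength yz.
pose F x := ((h x)^-1 * \1_(`](t y), (t z)]) x)%:E.
transitivity (\int[mu]_(u in `]0%R, L]) F (t u))%E.
  rewrite integral_mkcond [RHS]integral_mkcond; apply: eq_integral => u _.
  rewrite !patchE /k /inv_speed /F !indicE.
  have [|] := boolP (u \in `]0%R, L]%classic); last first.
    by rewrite mulr0; case: ifP.
  rewrite inE/= in_itv/= => /andP[u0 uL]; rewrite mulr1.
  rewrite mem_setE [in RHS]mem_setE !in_itv/= inv_arclength_lt//.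
  rewrite [t u <= _]leNgt inv_arclength_lt// -leNgt.
  by case: ifP => _; rewrite ?mulr1 ?mulr0.
rewrite ge0_integral_inv_arclength; last 2 first.
- apply/measurable_EFinP; apply: measurable_funM; last exact: measurable_indic.
  exact: measurable_invr_gt0.
- by move=> x; rewrite lee_fin mulr_ge0// invr_ge0.
transitivity (\int[mu]_(x in D) (\1_(`](t y), (t z)]) x)%:E)%E.
  apply: eq_integral => x _; rewrite /F -EFinM mulrAC mulVf ?mul1r//.
  by rewrite gt_eqF.
rewrite integral_indic// setIidl; last first.
  move=> x /=; rewrite !in_itv/= => /andP[tyx xtz].
  by rewrite (le_lt_trans (tax y))//= (le_trans xtz).
rewrite [LHS]lebesgue_measure_itv/= lte_fin; case: ifPn => //.
rewrite -leNgt => zy.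
by rewrite (le_anti (introT andP (conj tyz zy))) subrr.
Qed.

(** The points that are not Lebesgue points of [h] form a null set; its preimage
    under [t] is null because the image measure has a density. *)
Lemma ae_is_derive_arclength : {ae mu, forall y, 0 < y < L ->
  is_derive (t y) (1 : R) s (h (t y))}.
Proof.
have [A [mA A0 NA]] := lebesgue_differentiation (locally_integrable_speed gP).
exists (t @^-1` A `&` `]0, L]%classic); split.
- apply: measurableI => //; rewrite -[X in measurable X]setTI.
  exact: measurable_inv_arclength.
- rewrite [LHS]lebesgue_measure_inv_arclength//.
  apply: null_set_integral => //.
  + exact: measurableI.
  + by apply/measurable_EFinP; exact: measurable_funTS.
  + by apply: subset_measure0 A0 => //; exact: measurableI.
move=> y /= /not_implyP[/andP[y0 yL] dy]; split; last first.
  by rewrite in_itv/= y0 ltW.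
apply: NA => /= /(is_derive_arclength gP); apply: contra_not dy; apply.
rewrite -(ltr_s (lexx a) (tax y)) s_a arclength_inv_in ?y0//.
by rewrite !ltW.
Qed.

End inv_arclength.

(** * Stability of the inverse arc length under perturbation of the speed *)

Section indicators.
Context {R : realType}.
Notation mu := (@lebesgue_measure R).

(** The two indicators differ only between [x] and [y]. *)
Lemma integral_indic_itv_dist (x y : R) :
  (\int[mu]_u `|\1_(`]0, x]) u - \1_(`]0, y]) u|%:E <= `|x - y|%:E)%E.
Proof.
pose I := `](Num.min x y), (Num.max x y)]%classic.
have mI : measurable I by exact: measurable_itv.
apply: (@le_trans _ _ (\int[mu]_u (\1_I u)%:E)%E).
  apply: ge0_le_integral => //.
  - apply/measurable_EFinP; apply: measurableT_comp => //.
    by apply: measurable_funB; exact: measurable_indic.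
  - by apply/measurable_EFinP; exact: measurable_indic.
  move=> u _; rewrite lee_fin !indicE /I !mem_setE !in_itv/= gt_min le_max.
  have [u0|u0] := ltP 0 u; rewrite /= ?subrr ?normr0//.
  by have [ux|ux] := leP u x; have [uy|uy] := leP u y;
    rewrite /= ?subrr ?subr0 ?sub0r ?normrN ?normr0 ?normr1.
rewrite integral_indic// setIT.
rewrite [leLHS](lebesgue_measure_itv `](Num.min x y), (Num.max x y)])/= lte_fin.
case: ifPn => _; last by rewrite lee_fin.
rewrite -EFinB lee_fin /Num.min /Num.max; case: ifPn => xy.
  by rewrite distrC ler_norm.
by rewrite ler_norm.
Qed.

End indicators.

Section uniform_continuity.
Context {R : realType}.

Lemma continuous_uniform_itv (c : R -> R) (A B e : R) : continuous c -> 0 < e ->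
  exists2 d, 0 < d & forall x y, A <= x <= B -> `|x - y| < d ->
    `|c x - c y| <= e.
Proof.
move=> cc e0.
have /compact_near_coveringP cK := @segment_compact R A B.
have := cK _ (0^'+) (fun d x => forall y, `|x - y| < d -> `|c x - c y| <= e) _.
case=> [x _|r /= r0 rP].
  have /cvgrPdist_lt /(_ (e / 2)) := cc x.
  rewrite divr_gt0// => /(_ isT) [r /= r0 rP].
  exists (ball x (r / 2), [set d | d < r / 2]).
    split; first by apply: nbhsx_ballx; rewrite divr_gt0.
    by apply: nbhs_right_lt; rewrite divr_gt0.
  move=> [x' d] /= [xx' dr] y x'y; have xr : ball x r x'.
    by apply: le_ball xx'; rewrite ler_pdivrMr// ler_pMr// ler1n.
  have yr : ball x r y.
    rewrite (splitr r); apply: ball_triangle xx' _.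
    exact: lt_trans x'y dr.
  rewrite (splitr e) (le_trans (ler_distD (c x) _ _))// lerD//.
    by rewrite distrC ltW// rP.
  by rewrite ltW// rP.
exists (r / 2); first by rewrite divr_gt0.
move=> x y /andP[Ax xB]; apply: (rP (r / 2)) => //=.
- by rewrite sub0r normrN gtr0_norm ?divr_gt0// ltr_pdivrMr// ltr_pMr// ltr1n.
- by rewrite divr_gt0.
- by rewrite in_itv/= Ax xB.
Qed.

Lemma continuous_bounded_itv (c : R -> R) (A B : R) : continuous c ->
  exists2 M, 0 <= M & forall x, A <= x <= B -> `|c x| <= M.
Proof.
move=> cc.
have /compact_bounded[M [_ MP]] : compact (c @` `[A, B]).
  apply: continuous_compact; last exact: segment_compact.
  exact: continuous_subspaceT.
exists (`|M| + 1); first by rewrite addr_ge0.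
move=> x xAB; apply: (MP (`|M| + 1)).
  by rewrite (le_lt_trans (ler_norm M))// ltrDl.
by exists x => //=; rewrite in_itv.
Qed.

End uniform_continuity.

Section inv_speed_approximation.
Context {R : realType}.
Notation mu := (@lebesgue_measure R).
Variables (a b eps : R) (g t c : R -> R).
Hypotheses (tP : is_inv_arclength a b eps g t) (cc : continuous c).
Let s := arclength a eps g.
Let gP : is_speed a b eps g. Proof. by case: tP. Qed.

(** [s] itself is monotone only on the right of [a]. *)
Lemma measurable_arclength : measurable_fun [set: R] (fun x => s (Num.max a x)).
Proof.
apply: nondecreasing_measurable => // x y xy.
have amax z : a <= Num.max a z by rewrite le_max lexx.
by rewrite /s (ler_arclength gP)// ge_max !le_max lexx xy orbT.
Qed.

Lemma measurable_speed_defect :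
  measurable_fun `]a, b] (fun x => 1 - c (s x) * (eps + g x)).
Proof.
apply: measurable_funB => //; apply: measurable_funM; last first.
  exact: measurable_funTS (measurable_speed gP).
apply: (@eq_measurable_fun _ _ _ _ _ (fun x => c (s (Num.max a x)))).
  by move=> x; rewrite inE/= in_itv/= => /andP[/ltW/max_idPr -> _].
apply: measurable_funTS.
apply: measurableT_comp measurable_arclength.
exact: continuous_measurable_fun.
Qed.

(** The key identity. With [h = eps + g], the substitution [y = s x] turns
    [|k y - c y|] into [|1 / h x - c (s x)| * h x = |1 - c (s x) * h x|]. The
    right-hand side no longer involves [t], and depends on [g] in a way that is
    stable under L^1 perturbations when [c] is continuous. *)
Lemma integral_inv_speed_defect :
  (\int[mu]_(y in `]0%R, s b]) `|inv_speed a b eps g t y - c y|%:E =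
   \int[mu]_(x in `]a, b]) `|1 - c (s x) * (eps + g x)|%:E)%E.
Proof.
pose F x := `|(eps + g x)^-1 - c (s (Num.max a x))|%:E.
have [_ t_in _] := tP.
transitivity (\int[mu]_(y in `]0%R, s b]) F (t y))%E.
  apply: eq_integral => y; rewrite inE/= in_itv/= => /andP[y0 yL].
  have /andP[aty _] := t_in y.
  rewrite /F /inv_speed indicE mem_set/= ?in_itv/= ?y0// mulr1.
  by rewrite (max_idPr aty) /s (arclength_inv_in tP) ?(ltW y0).
rewrite (ge0_integral_inv_arclength tP); last 2 first.
- apply/measurable_EFinP; apply: measurableT_comp => //.
  apply: measurable_funB; last first.
    apply: measurableT_comp measurable_arclength.
    exact: continuous_measurable_fun.
  exact: measurable_invr_gt0 (speed_gt0 gP) (measurable_speed gP).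
- by move=> x; rewrite lee_fin.
apply: eq_integral => x; rewrite inE/= in_itv/= => /andP[ax _].
have h0 := speed_gt0 gP x; rewrite /F (max_idPr (ltW ax)) -EFinM.
rewrite -[X in _ * X](gtr0_norm h0) -normrM mulrBl mulVf//.
by rewrite gt_eqF.
Qed.

End inv_speed_approximation.

Section compare.
Context {R : realType}.
Notation mu := (@lebesgue_measure R).
Variables (a b eps dlt : R) (g1 g2 t1 t2 : R -> R).
Hypotheses (t1P : is_inv_arclength a b eps g1 t1)
  (t2P : is_inv_arclength a b eps g2 t2).
Hypothesis g12 : (\int[mu]_x `|g1 x - g2 x|%:E <= dlt%:E)%E.
Let s1 := arclength a eps g1.
Let s2 := arclength a eps g2.
Let g1P : is_speed a b eps g1. Proof. by case: t1P. Qed.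
Let g2P : is_speed a b eps g2. Proof. by case: t2P. Qed.

Let ig12 : mu.-integrable [set: R] (EFin \o (fun u => g1 u - g2 u)).
Proof.
have [_ _ i1 _] := g1P; have [_ _ i2 _] := g2P.
exact: (integrableB _ i1 i2).
Qed.

Let mg12 : measurable_fun [set: R] (fun u => g1 u - g2 u).
Proof. by apply/measurable_EFinP; exact: measurable_int ig12. Qed.

Lemma arclength_dist x : `|s1 x - s2 x| <= dlt.
Proof.
have i1 := integrable_speed_itv g1P false true a x.
have i2 := integrable_speed_itv g2P false true a x.
rewrite /s1 /s2 /arclength -RintegralB//.
rewrite (@eq_Rintegral _ _ _ mu _ (fun u => g1 u - g2 u)); last first.
  by move=> u _; rewrite opprD addrACA subrr add0r.
rewrite -lee_fin EFin_normr_Rintegral//; last exact: integrableS ig12.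
apply: le_trans g12; apply: le_trans (le_abse_integral _ _ _) _ => //.
  by apply/measurable_EFinP; exact: measurable_funTS.
apply: ge0_subset_integral => //.
by apply/measurable_EFinP; exact: measurableT_comp.
Qed.

(** [t1 y] and [t2 y] are at distance at most [|s1 (t1 y) - s1 (t2 y)| / eps].
    Replacing [s1 (t2 y)] with [s2 (t2 y)] costs [dlt]; then both terms are [y],
    clamped to [0, L1] and to [0, L2], which costs [dlt] again. *)
Lemma inv_arclength_dist y : `|t1 y - t2 y| <= 2 * dlt / eps.
Proof.
have [ab eps0 _ _] := g1P.
have [_ t1in st1] := t1P; have [_ t2in st2] := t2P.
have key x z : a <= x <= b -> a <= z <= b -> eps * `|x - z| <= `|s1 x - s1 z|.
  move=> /andP[ax xb] /andP[az zb]; wlog xz : x z ax az xb zb / x <= z => [hw|].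
    have [|/ltW] := leP x z; first exact: hw.
    by rewrite distrC (distrC (s1 x)); exact: hw.
  rewrite distrC (distrC (s1 x)) !ger0_norm ?subr_ge0 ?(ler_arclength g1P)//.
  exact: arclength_ge g1P _ _ ax xz.
rewrite ler_pdivlMr// mulrC; apply: le_trans (key _ _ (t1in y) (t2in y)) _.
have /= d1 := arclength_dist (t2 y); have /= d2 := arclength_dist b.
move: d1 d2; rewrite /s1 /s2 st1 st2; move: (arclength _ _ _ (t2 y)) => z.
rewrite !ler_norml /Num.max /Num.min.
by do ! case: ifPn; rewrite -?leNgt => *; lra.
Qed.

Let k1 := inv_speed a b eps g1 t1.
Let k2 := inv_speed a b eps g2 t2.
Let L1 := s1 b.
Let L2 := s2 b.

Section continuous_comparison.
Variables (c : R -> R) (w M : R).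
Hypotheses (cc : continuous c) (w0 : 0 <= w) (M0 : 0 <= M).

(** In the notation of [integral_inv_speed_defect], with [hi = eps + gi],
    [1 - c (s2) * h2] and [1 - c (s1) * h1] differ by
    [(c (s1) - c (s2)) * h1 + c (s2) * (h1 - h2)]; the integral of [h1] is [L1]. *)
Lemma inv_speed_defect_le :
  (forall x, a < x <= b -> `|c (s1 x) - c (s2 x)| <= w) ->
  (forall x, a < x <= b -> `|c (s2 x)| <= M) ->
  (\int[mu]_(y in `]0%R, L2]) `|k2 y - c y|%:E <=
   \int[mu]_(y in `]0%R, L1]) `|k1 y - c y|%:E + (w * L1 + M * dlt)%:E)%E.
Proof.
move=> cw cM; have [ab _ _ _] := g1P.
rewrite (integral_inv_speed_defect t1P cc) (integral_inv_speed_defect t2P cc).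
have m1 := measurable_speed_defect t1P cc.
have m2 := measurable_speed_defect t2P cc.
pose E1 x : \bar R := `|1 - c (s1 x) * (eps + g1 x)|%:E.
pose E2 x : \bar R := (w%:E * (eps + g1 x)%:E)%E.
pose E3 x : \bar R := (M%:E * `|g1 x - g2 x|%:E)%E.
have h1 x := speed_ge0 g1P x.
have mh1 : measurable_fun `]a, b] (fun x => (eps + g1 x)%:E).
  by apply/measurable_EFinP; exact: measurable_funTS (measurable_speed g1P).
have m12 : measurable_fun `]a, b] (fun x => `|g1 x - g2 x|%:E).
  by apply/measurable_EFinP; apply: measurableT_comp => //; exact: measurable_funTS.
have mE1 : measurable_fun `]a, b] E1.
  by apply/measurable_EFinP; exact: measurableT_comp.
have mE2 : measurable_fun `]a, b] E2 by exact: measurable_funeM.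
have mE3 : measurable_fun `]a, b] E3 by exact: measurable_funeM.
have E10 x : `]a, b]%classic x -> (0 <= E1 x)%E by rewrite /E1 lee_fin.
have E20 x : `]a, b]%classic x -> (0 <= E2 x)%E.
  by rewrite /E2 -EFinM lee_fin mulr_ge0.
have E30 x : `]a, b]%classic x -> (0 <= E3 x)%E.
  by rewrite /E3 -EFinM lee_fin mulr_ge0.
apply: (@le_trans _ _ (\int[mu]_(x in `]a, b]) (E1 x + (E2 x + E3 x)))%E).
  apply: ge0_le_integral => //.
  - by apply/measurable_EFinP; exact: measurableT_comp.
  - by apply: emeasurable_funD => //; exact: emeasurable_funD.
  move=> x /=; rewrite in_itv/= => axb.
  rewrite /E1 /E2 /E3 -!EFinM -!EFinD lee_fin.
  have -> : 1 - c (s2 x) * (eps + g2 x) = 1 - c (s1 x) * (eps + g1 x) +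
      ((c (s1 x) - c (s2 x)) * (eps + g1 x) + c (s2 x) * (g1 x - g2 x)) by ring.
  apply: (le_trans (ler_normD _ _)); rewrite lerD2l.
  apply: (le_trans (ler_normD _ _)); rewrite !normrM (ger0_norm (h1 x)).
  by rewrite lerD// ler_wpM2r// ?cw ?cM.
rewrite ge0_integralD//; last 2 first.
- by move=> x xab; rewrite adde_ge0 ?E20 ?E30.
- exact: emeasurable_funD.
rewrite leeD2l// ge0_integralD// EFinD; apply: leeD.
  rewrite ge0_integralZl_EFin//; last by move=> x _; rewrite lee_fin.
  rewrite (integral_speed g1P)// ?(ltW ab)//.
  by rewrite -EFinM arclength_a subr0.
rewrite ge0_integralZl_EFin// EFinM lee_wpmul2l ?lee_fin//.
apply: le_trans g12; apply: ge0_subset_integral => //.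
by apply/measurable_EFinP; exact: measurableT_comp.
Qed.

(** The triangle inequality through [c] is used on the intersection of ]0, L1]
    and ]0, L2]. On their symmetric difference, of length at most [dlt], one of
    the two functions vanishes and the other is at most [eps^-1]. *)
Lemma inv_speed_dist_le :
  (\int[mu]_y `|k1 y - k2 y|%:E <=
   \int[mu]_(y in `]0%R, L1]) `|k1 y - c y|%:E +
   (\int[mu]_(y in `]0%R, L2]) `|k2 y - c y|%:E + (dlt / eps)%:E))%E.
Proof.
have [ab eps0 _ _] := g1P.
have mk1 := measurable_inv_speed t1P; have mk2 := measurable_inv_speed t2P.
have mc := continuous_measurable_fun cc.
have eV0 : 0 <= eps^-1 by rewrite invr_ge0 ltW.
have ek1 y : `|k1 y| <= eps^-1.
  by rewrite ger0_norm; [exact: inv_speed_le t1P y|exact: inv_speed_ge0 t1P y].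
have ek2 y : `|k2 y| <= eps^-1.
  by rewrite ger0_norm; [exact: inv_speed_le t2P y|exact: inv_speed_ge0 t2P y].
pose E1 := (fun y => `|k1 y - c y|%:E) \_ `]0, L1].
pose E2 := (fun y => `|k2 y - c y|%:E) \_ `]0, L2].
pose I y : \bar R := `|\1_(`]0, L1]) y - \1_(`]0, L2]) y|%:E.
pose E3 y : \bar R := (eps^-1%:E * I y)%E.
have mE1 : measurable_fun [set: R] E1.
  apply/(measurable_restrictT _ _).1 => //; apply: measurable_funTS.
  by apply/measurable_EFinP/measurableT_comp => //; exact: measurable_funB.
have mE2 : measurable_fun [set: R] E2.
  apply/(measurable_restrictT _ _).1 => //; apply: measurable_funTS.
  by apply/measurable_EFinP/measurableT_comp => //; exact: measurable_funB.
have mI : measurable_fun [set: R] I.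
  apply/measurable_EFinP/measurableT_comp => //.
  by apply: measurable_funB; exact: measurable_indic.
have mE3 : measurable_fun [set: R] E3 by exact: measurable_funeM.
have E10 y : (0 <= E1 y)%E by apply: erestrict_ge0 => x _; rewrite lee_fin.
have E20 y : (0 <= E2 y)%E by apply: erestrict_ge0 => x _; rewrite lee_fin.
have E30 y : (0 <= E3 y)%E by rewrite /E3 -EFinM lee_fin mulr_ge0.
apply: (@le_trans _ _ (\int[mu]_y (E1 y + (E2 y + E3 y)))%E).
  apply: ge0_le_integral => //.
  - by apply/measurable_EFinP/measurableT_comp => //; exact: measurable_funB.
  - by apply: emeasurable_funD => //; exact: emeasurable_funD.
  move=> y _; rewrite /E1 /E2 /E3 /I !patchE.
  have k1_0 : (0 < y <= L1) = false -> k1 y = 0.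
    by rewrite /k1 /inv_speed indicE mem_setE in_itv/= => ->; rewrite mulr0.
  have k2_0 : (0 < y <= L2) = false -> k2 y = 0.
    by rewrite /k2 /inv_speed indicE mem_setE in_itv/= => ->; rewrite mulr0.
  have tri : `|k1 y - k2 y| <= `|k1 y - c y| + `|k2 y - c y|.
    by rewrite (distrC (k2 y)) ler_distD.
  rewrite !indicE !mem_setE !in_itv/= -!EFinM.
  case: ifPn => in1; case: ifPn => in2; rewrite ?add0e ?adde0 -?EFinD lee_fin/=.
  - by rewrite subrr normr0 mulr0 addr0.
  - by rewrite k2_0 ?(negbTE in2)// !subr0 normr1 mulr1 ler_wpDl.
  - by rewrite k1_0 ?(negbTE in1)// !sub0r !normrN normr1 mulr1 ler_wpDl.
  - by rewrite k1_0 ?k2_0 ?(negbTE in1) ?(negbTE in2)// subrr normr0 mulr0.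
rewrite ge0_integralD//; last 2 first.
- by move=> y _; rewrite adde_ge0.
- exact: emeasurable_funD.
rewrite -integral_mkcond leeD2l// ge0_integralD//.
rewrite -integral_mkcond leeD2l// ge0_integralZl_EFin//; last first.
  by move=> y _; rewrite lee_fin.
rewrite [dlt / eps]mulrC EFinM.
apply: lee_wpmul2l; first by rewrite lee_fin.
apply: (le_trans (integral_indic_itv_dist _ _)); rewrite lee_fin.
exact: arclength_dist.
Qed.

End continuous_comparison.

End compare.

Section convergence.
Context {R : realType}.
Notation mu := (@lebesgue_measure R).
Variables (a b eps : R) (g t : R -> R) (gn tn : nat -> R -> R) (dlt : nat -> R).
Hypotheses (tP : is_inv_arclength a b eps g t)
  (tnP : forall n, is_inv_arclength a b eps (gn n) (tn n)).
Hypothesis g_gn : forall n, (\int[mu]_x `|g x - gn n x|%:E <= (dlt n)%:E)%E.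
Hypothesis dlt0 : dlt n @[n --> \oo] --> 0.
Let s := arclength a eps g.
Let L := s b.
Let k := inv_speed a b eps g t.
Let gP : is_speed a b eps g. Proof. by case: tP. Qed.

Lemma continuous_approximation_inv_speed (e : R) : 0 < e ->
  exists2 c, continuous c &
    (\int[mu]_(y in `]0%R, L]) `|k y - c y|%:E <= e%:E)%E.
Proof.
move=> e0; have finL : (mu `]0%R, L] < +oo)%E.
  by rewrite lebesgue_measure_itv/=; case: ifP => // _; rewrite -EFinB ltry.
have ik : mu.-integrable `]0, L] (EFin \o k).
  apply: measurable_bounded_integrable => //.
    exact: measurable_funTS (measurable_inv_speed tP).
  exists eps^-1; split => [|M ltM y _ /=]; first exact: num_real.
  rewrite ger0_norm; first exact: le_trans (inv_speed_le tP y) (ltW ltM).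
  exact: inv_speed_ge0 tP y.
have [c [cc ic /fine_cvgP[cfin]]] :=
  approximation_continuous_integrable (measurable_itv _) finL ik.
move=> /cvgrPdist_le /(_ e e0) cle; near \oo => n.
exists (c n) => //.
have cn : (\int[mu]_(y in `]0%R, L]) `|k y - c n y|%:E)%E \is a fin_num.
  by near: n; exact: cfin.
rewrite -(fineK cn) lee_fin.
have : `|0 - fine (\int[mu]_(y in `]0%R, L]) `|k y - c n y|%:E)%E| <= e.
  by near: n; exact: cle.
by rewrite sub0r normrN; apply: le_trans; exact: ler_norm.
Unshelve. all: by end_near. Qed.

(** The approximation [c] is fixed before [n]; its uniform continuity on [0, L]
    absorbs the distance from [s] to [s_n], and its boundedness on [0, L + 1], an
    interval that contains [s_n x] for large [n], absorbs that from [g] to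
    [g_n]. *)
Lemma cvg_inv_speed (e : R) : 0 < e ->
  \forall n \near \oo,
    (\int[mu]_y `|k y - inv_speed a b eps (gn n) (tn n) y|%:E <= e%:E)%E.
Proof.
move=> e0; have [ab eps0 _ _] := gP.
have L0 : 0 < L by exact: arclength_b_gt0 gP.
(* One fifth of [e] for the distance from [k] to [c], once as such and once in the
   bound on the distance from [k_n] to [c], and one for each of the terms
   [w * L], [M * dlt n] and [dlt n / eps]. *)
have e50 : 0 < e / 5 by rewrite divr_gt0.
have [c cc kc] := continuous_approximation_inv_speed e50.
have [M M0 cM] := @continuous_bounded_itv R c 0 (L + 1) cc.
have [d d0 cd] := @continuous_uniform_itv R c 0 L (e / 5 / L) cc (divr_gt0 e50 L0).
near=> n.
have dltn : `|dlt n| < d by near: n; apply: cvgr0_norm_lt.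
have dltn1 : `|dlt n| <= 1 by near: n; apply: cvgr0_norm_le.
have dltnM : `|dlt n| <= e / 5 / (M + 1).
  by near: n; apply: cvgr0_norm_le => //; rewrite divr_gt0// ltr_wpDl.
have dltne : `|dlt n| <= e / 5 * eps.
  by near: n; apply: cvgr0_norm_le => //; rewrite mulr_gt0.
have gnP : is_speed a b eps (gn n) by case: (tnP n).
have sd x : `|s x - arclength a eps (gn n) x| <= dlt n.
  exact: (arclength_dist tP (tnP n) (g_gn n)).
have sL x : a < x <= b -> 0 <= s x <= L.
  move=> /andP[ax xb]; rewrite (arclength_ge0 gP) ?(ltW ax)//=.
  by rewrite /L /s (ler_arclength gP)// ltW.
apply: le_trans (inv_speed_dist_le tP (tnP n) (g_gn n) cc) _.
have cw x : a < x <= b -> `|c (s x) - c (arclength a eps (gn n) x)| <= e / 5 / L.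
  move=> /sL xL; apply: cd => //.
  by apply: le_lt_trans (sd x) _; apply: le_lt_trans (ler_norm _) dltn.
have cMn x : a < x <= b -> `|c (arclength a eps (gn n) x)| <= M.
  move=> xab; have /andP[s0 sxL] := sL x xab; apply: cM.
  have /andP[ax _] := xab.
  rewrite (arclength_ge0 gnP) ?(ltW ax)//=.
  have := sd x; rewrite ler_norml => ?; have := ler_norm (dlt n); lra.
have w0 : 0 <= e / 5 / L by rewrite divr_ge0 ?ltW.
have := inv_speed_defect_le tP (tnP n) (g_gn n) cc w0 M0 cw cMn.
move=> /(leeD2r (dlt n / eps)%:E) /(leeD kc) /le_trans; apply.
apply: (@le_trans _ _ ((e / 5)%:E +
    ((e / 5)%:E + (e / 5 / L * L + M * dlt n)%:E + (dlt n / eps)%:E))%E).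
  by rewrite leeD2l// leeD2r// leeD2r.
rewrite -!EFinD lee_fin divfK ?gt_eqF//.
have dn0 : 0 <= dlt n := le_trans (normr_ge0 _) (sd a).
rewrite ger0_norm// in dltnM dltne.
have h1 : M * dlt n <= e / 5.
  apply: le_trans (_ : (M + 1) * dlt n <= _); first by rewrite ler_wpM2r// lerDl.
  by rewrite mulrC -ler_pdivlMr// ltr_wpDl.
have h2 : dlt n / eps <= e / 5 by rewrite ler_pdivrMr.
lra.
Unshelve. all: by end_near. Qed.

End convergence.

(** * Metric slopes *)

Section slope_measurability.
Context {R : realType} {X : metricType R}.

Lemma mdist_lip (x x' y y' : X) :
  `|mdist x y - mdist x' y'| <= mdist x x' + mdist y y'.
Proof.
have h1 := metric_triangle x x' y; have h2 := metric_triangle x' y' y.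
have h3 := metric_triangle x' x y'; have h4 := metric_triangle x y y'.
rewrite (metric_sym x' x) in h3; rewrite (metric_sym y' y) in h2.
by rewrite ler_norml; apply/andP; split; lra.
Qed.

Lemma continuous_mdist (phi psi : R -> X) y :
  {for y, continuous phi} -> {for y, continuous psi} ->
  {for y, continuous (fun z => mdist (phi z) (psi z))}.
Proof.
move=> cphi cpsi; apply/cvgrPdist_le => e e0.
have e20 : 0 < e / 2 by rewrite divr_gt0.
near=> z; apply: (le_trans (mdist_lip _ _ _ _)); rewrite (splitr e) lerD//.
- by near: z; exact: metricType_numDomainType.cvgr_dist_le cphi _ e20.
- by near: z; exact: metricType_numDomainType.cvgr_dist_le cpsi _ e20.
Unshelve. all: by end_near. Qed.

Variable phi : R -> X.
Let quot r y := mdist (phi y) (phi (y + r)) / `|r|.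
Let osc (k m : nat) : set R := [set y | forall r r', 0 < `|r| < m.+1%:R^-1 ->
  0 < `|r'| < m.+1%:R^-1 -> `|quot r y - quot r' y| <= k.+1%:R^-1].

(** The Cauchy criterion for the difference quotients: their oscillation over the
    increments [r] smaller than [m.+1%:R^-1] is small. *)
Lemma is_cvg_slopeP y :
  cvg (mdist (phi y) (phi z) / `|y - z| @[z --> y^']) <->
  (\bigcap_k \bigcup_m osc k m) y.
Proof.
have quotE z : mdist (phi y) (phi z) / `|y - z| = quot (z - y) y.
  by rewrite /quot subrKC distrC.
split=> [/cvg_ex[l /cvgrPdist_lt ql] k _|ymk].
  have k0 : 0 < (k.+1%:R^-1 : R) / 2 by rewrite divr_gt0// invr_gt0.
  have [d /= d0 dP] := ql _ k0.
  have [m _ /(_ _ (leqnn m)) /= md] := near_infty_natSinv_lt (PosNum d0).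
  have key r : 0 < `|r| < m.+1%:R^-1 -> `|l - quot r y| < k.+1%:R^-1 / 2.
    move=> /andP[r0 rm]; have := dP (y + r).
    rewrite quotE (addrC y) addrK /= distrC addrK; apply; first exact: lt_trans md.
    by rewrite eq_sym addrC -subr_eq0 opprD addrA subrr sub0r oppr_eq0 -normr_gt0.
  exists m => // r r' rm r'm.
  rewrite (splitr k.+1%:R^-1) (le_trans (ler_distD l _ _))// lerD//.
    by rewrite distrC ltW// key.
  by rewrite ltW// key.
apply: cauchy_cvg; apply: cauchy_exP => e e0.
have [k _ /(_ _ (leqnn k)) /= ke] := near_infty_natSinv_lt (PosNum e0).
have [m _ ykm] := ymk k I.
pose r0 : R := m.+1%:R^-1 / 2.
have r00 : 0 < r0 by rewrite divr_gt0// invr_gt0.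
have r0m : 0 < `|r0| < m.+1%:R^-1.
  by rewrite gtr0_norm// r00 /r0 ltr_pdivrMr// ltr_pMr ?ltr1n// invr_gt0.
exists (quot r0 y); near=> z => /=; rewrite quotE /ball/=.
apply: le_lt_trans ke; apply: ykm => //.
have : (ball y m.+1%:R^-1 `\ y) z.
  by near: z; apply: dnbhs_ball; rewrite invr_gt0.
by move=> [/= yz /eqP zy]; rewrite normr_gt0 subr_eq0 zy distrC.
Unshelve. all: by end_near. Qed.

Hypothesis cphi : continuous phi.

Let continuous_quot r : continuous (quot r).
Proof.
move=> y; apply: cvgMr_tmp; apply: continuous_mdist; first exact: cphi.
apply: continuous_comp; last exact: cphi.
by apply: cvgD; [exact: cvg_id|exact: cvg_cst].
Qed.

(** For fixed [r] and [r'] the condition in [osc] is closed, and arbitrary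
    intersections of closed sets are closed, so that [r] and [r'] may range over
    all real increments. *)
Lemma closed_slope_osc k m : closed (osc k m).
Proof.
pose P := [set p : R * R |
  0 < `|p.1| < m.+1%:R^-1 /\ 0 < `|p.2| < m.+1%:R^-1].
rewrite (_ : osc k m = \bigcap_(p in P)
    ((fun y => `|quot p.1 y - quot p.2 y|) @^-1` [set c | c <= k.+1%:R^-1])).
  apply: closed_bigI => p [p10 p20]; apply: closed_comp; last exact: closed_le.
  by move=> y _; apply: cvg_norm; apply: cvgB; exact: continuous_quot.
apply/seteqP; split => [y yo [r r'] [/= rm r'm]|y yP r r' rm r'm].
  exact: yo.
by apply: (yP (r, r')).
Qed.

(** The limit exists on a countable intersection of countable unions of closed
    sets; there it is a limit of continuous functions along the increments
    [n.+1%:R^-1]. Elsewhere the slope takes the default value [0]. *)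
Lemma measurable_metric_slope : measurable_fun [set: R] (metric_slope phi).
Proof.
pose E := \bigcap_k \bigcup_m osc k m.
have mE : measurable E.
  apply: bigcapT_measurable => k; apply: bigcupT_measurable => m.
  by apply: closed_measurable; exact: closed_slope_osc.
have -> : metric_slope phi = metric_slope phi \_ E.
  apply/funext => y; rewrite patchE; case: ifPn => // /negP.
  rewrite inE => /is_cvg_slopeP; exact: dvgP.
suff sE : measurable_fun E (metric_slope phi).
  exact: (measurable_restrictT _ mE).1 sE.
have mq n : measurable_fun E (quot n.+1%:R^-1).
  by apply: measurable_funTS; apply: continuous_measurable_fun.
apply: measurable_fun_cvg mq _ => y.
move=> /is_cvg_slopeP /cvg_dnbhs_at_right /cvg_at_rightP sy.
have uy : (forall n, y < y + n.+1%:R^-1) /\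
    (y + n.+1%:R^-1 @[n --> \oo] --> y).
  split => [n|]; first by rewrite ltrDl invr_gt0.
  rewrite -[X in _ --> X]addr0; apply: cvgD; first exact: cvg_cst.
  exact: cvg_harmonic.
have := sy _ uy; apply: cvg_trans; apply: near_eq_cvg; near=> n.
by rewrite /quot opprD addrA subrr sub0r normrN.
Unshelve. all: by end_near. Qed.

End slope_measurability.

Section slope_local.
Context {R : realType} {X : metricType R}.
Implicit Types phi psi : R -> X.

Lemma near_eq_metric_slope phi psi y :
  (\forall z \near y, phi z = psi z) -> metric_slope phi y = metric_slope psi y.
Proof.
move=> e; have ey : phi y = psi y by exact: nbhs_singleton e.
have e' : \forall z \near y^', mdist (phi y) (phi z) / `|y - z| =
    mdist (psi y) (psi z) / `|y - z|.
  by apply: filterS (nbhs_dnbhs e) => z ->; rewrite ey.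
rewrite /metric_slope; congr (lim _); apply/seteqP; split; apply: near_eq_cvg.
  exact: e'.
by apply: filterS e' => z ->.
Qed.

Lemma near_eq_continuous_for (phi psi : R -> X) y :
  (\forall z \near y, phi z = psi z) -> {for y, continuous phi} ->
  {for y, continuous psi}.
Proof.
move=> e cphi; rewrite /prop_for /continuous_at -(nbhs_singleton e).
by apply: cvg_trans cphi; apply: near_eq_cvg.
Qed.

Lemma metric_slope_ge0 phi x : 0 <= metric_slope phi x.
Proof.
rewrite /metric_slope; set q := (fun y => _).
have [cq|dq] := pselect (cvg (q y @[y --> x^'])); last by rewrite (dvgP dq).
apply: limr_ge => //; near=> y.
by rewrite divr_ge0// mdist_ge0.
Unshelve. all: by end_near. Qed.

Lemma metric_slope_const phi (p : X) y :
  (\forall z \near y, phi z = p) -> metric_slope phi y = 0.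
Proof.
move=> /near_eq_metric_slope ->; apply: cvg_lim => //.
by under eq_fun do rewrite mdistxx mul0r; exact: cvg_cst.
Qed.

Lemma continuous_clamp (c d : R) :
  continuous (fun z : R => Num.max c (Num.min z d)).
Proof.
move=> y; apply: (@continuous_max _ _ (cst c) (fun z => Num.min z d)).
  exact: cvg_cst.
by apply: (@continuous_min _ _ id (cst d)); [exact: cvg_id|exact: cvg_cst].
Qed.

(** Slopes are local: on an interval of an exhaustion of ]p, q[ the slope is that
    of [phi] precomposed with a clamping, which is continuous everywhere. *)
Lemma measurable_metric_slope_itv phi (p q : R) :
  (forall y, p < y < q -> {for y, continuous phi}) ->
  measurable_fun `]p, q[ (metric_slope phi).
Proof.
move=> cphi; pose c n := p + n.+1%:R^-1; pose d n := q - n.+1%:R^-1.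
have V0 n : 0 < n.+1%:R^-1 :> R by rewrite invr_gt0.
rewrite (_ : `]p, q[%classic = \bigcup_n `](c n), (d n)[%classic); last first.
  apply/seteqP; split => [y /=|y [n _ /=]]; rewrite !in_itv/= => /andP[py yq].
    have m0 : 0 < Num.min (y - p) (q - y) by rewrite lt_min !subr_gt0 py.
    have [n _ /(_ _ (leqnn n)) /=] := near_infty_natSinv_lt (PosNum m0).
    rewrite lt_min => /andP[np nq]; exists n => //=.
    by rewrite in_itv/= /c /d ltrBrDr -ltrBrDl nq -ltrBrDl np.
  have := V0 n; move: py yq; rewrite /c /d; move: (n.+1%:R^-1) => v *.
  by apply/andP; split; lra.
apply/measurable_fun_bigcup => [n|n]; first exact: measurable_itv.
have [cd|dc] := ltP (c n) (d n); last first.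
  by rewrite set_itv_ge ?bnd_simp -?leNgt//; exact: measurable_fun_set0.
pose psi z := phi (Num.max (c n) (Num.min z (d n))).
have cpsi : continuous psi.
  move=> z; apply: continuous_comp; first exact: continuous_clamp.
  apply: cphi; have := V0 n; move: cd; rewrite /c /d.
  move: (n.+1%:R^-1) => v; rewrite /Num.max /Num.min.
  by do ! case: ifPn; rewrite -?leNgt => *; apply/andP; split; lra.
apply: (@eq_measurable_fun _ _ _ _ _ (metric_slope psi)).
  move=> y; rewrite inE/= => yin; apply: near_eq_metric_slope.
  near=> z; have : z \in `](c n), (d n)[.
    by near: z; apply: open_nbhs_nbhs; split => //; exact: interval_open.
  by rewrite in_itv/= => /andP[cz zd]; rewrite /psi min_l ?max_r ?ltW.
by apply: measurable_funTS; exact: measurable_metric_slope.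
Unshelve. all: by end_near. Qed.

(** The chain rule for slopes, stated with the derivative of the inverse [s] of
    [t], because the derivative of the arc length is what is known. Since [s] and
    [t] are local homeomorphisms with [s' x = v <> 0], the difference quotients of
    [phi o t] at [y] converge if and only if those of [phi] at [x] do; when they
    do not, both slopes take the default value [0]. *)
Lemma metric_slope_comp phi (s t : R -> R) (x y v : R) : 0 < v ->
  t y = x -> s x = y -> is_derive x (1 : R) s v -> {for y, continuous t} ->
  (\forall z \near y, s (t z) = z) -> (\forall u \near x, t (s u) = u) ->
  metric_slope (phi \o t) y = metric_slope phi x / v.
Proof.
move=> v0 ty sx ds ct sK tK.
have cs : {for x, continuous s}.
  by apply: differentiable_continuous; apply/derivable1_diffP; case: ds.
have /cvgrPdist_lt ct' := ct; have /cvgrPdist_lt cs' := cs.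
have tcv : t z @[z --> y^'] --> x^'.
  move=> A [e /= e0 eA]; suff : \forall z \near y^', A (t z) by [].
  near=> z; apply: eA.
    rewrite /= -ty; near: z; apply: nbhs_dnbhs; exact: ct'.
  apply/eqP => tzx; have : s (t z) = y by rewrite tzx.
  have -> : s (t z) = z by near: z; exact: nbhs_dnbhs sK.
  by apply/eqP; near: z; exact: nbhs_dnbhs_neq.
have scv : s u @[u --> x^'] --> y^'.
  move=> A [e /= e0 eA]; suff : \forall u \near x^', A (s u) by [].
  near=> u; apply: eA.
    rewrite /= -sx; near: u; apply: nbhs_dnbhs; exact: cs'.
  apply/eqP => suy; have : t (s u) = x by rewrite suy.
  have -> : t (s u) = u by near: u; exact: nbhs_dnbhs tK.
  by apply/eqP; near: u; exact: nbhs_dnbhs_neq.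
(* [s u - s x = G u * (u - x)] with [G] continuous at [x] and [G x = v], so that
   the difference quotients [Q] at [u] and [q] at [s u] differ by a factor [|G u|]. *)
have /is_derive1_caratheodory[G [Gs cG Gx]] := ds.
pose Q u := mdist (phi x) (phi u) / `|x - u|.
pose q z := mdist (phi (t y)) (phi (t z)) / `|y - z|.
have qQ : \forall u \near x^', q (s u) * `|G u| = Q u.
  near=> u.
  have tsu : t (s u) = u by near: u; exact: nbhs_dnbhs tK.
  have ux : u != x by near: u; exact: nbhs_dnbhs_neq.
  rewrite /q /Q tsu ty; have := Gs u; rewrite sx => suE.
  have yu : `|y - s u| = `|G u| * `|x - u|.
    by rewrite distrC suE normrM (distrC x).
  have su0 : `|y - s u| != 0.
    rewrite normr_eq0 subr_eq0; apply/eqP => yE.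
    by move/eqP: ux; apply; rewrite -tsu -yE.
  have xu0 : `|x - u| != 0 by rewrite normr_eq0 subr_eq0 eq_sym.
  have Gu0 : `|G u| != 0 by move: su0; rewrite yu mulf_eq0 negb_or => /andP[].
  by rewrite yu; field; rewrite Gu0 xu0.
have Gcv : `|G u| @[u --> x^'] --> v.
  rewrite -[v]gtr0_norm//; apply: cvg_norm.
  apply: cvg_trans (cvg_app _ (@nbhs_dnbhs _ x)) _; rewrite -Gx; exact: cG.
have Gt : `|G (t z)| @[z --> y^'] --> v := cvg_comp _ _ tcv Gcv.
have Qq : \forall z \near y^', Q (t z) / `|G (t z)| = q z.
  near=> z.
  have stz : s (t z) = z by near: z; exact: nbhs_dnbhs sK.
  have <- : q (s (t z)) * `|G (t z)| = Q (t z) by near: z; exact: tcv qQ.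
  rewrite stz mulfK//; apply: lt0r_neq0; near: z.
  exact: cvgr_gt Gt _ v0.
rewrite /metric_slope.
have [[l Ql]|dQ] := pselect (exists l : R, Q u @[u --> x^'] --> l).
  have ql : q z @[z --> y^'] --> l / v.
    have : Q (t z) / `|G (t z)| @[z --> y^'] --> l / v.
      apply: cvgM; first exact: cvg_comp tcv Ql.
      by apply: cvgV => //; rewrite gt_eqF.
    exact: cvg_trans (near_eq_cvg Qq).
  by rewrite (cvg_lim _ Ql)// (cvg_lim _ ql).
rewrite [in RHS]dvgP; last by move=> /cvg_ex[l Ql]; apply: dQ; exists l.
rewrite [LHS]dvgP ?mul0r// => /cvg_ex[l ql]; apply: dQ; exists (l * v).
have : q (s u) * `|G u| @[u --> x^'] --> l * v.
  by apply: cvgM => //; exact: cvg_comp scv ql.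
exact: cvg_trans (near_eq_cvg qQ).
Unshelve. all: by end_near. Qed.

End slope_local.

(** * L^q norms of bounded functions *)

Lemma in_L1_integrable {R : realType} (D : set R) (f : R -> R) : measurable D ->
  in_Lq D 1 f -> lebesgue_measure.-integrable [set: R] (EFin \o (f \_ D)).
Proof.
move=> mD [mf]; rewrite /Lq_norm Lnorm1 => foo; apply/integrableP; split=> //.
by apply/measurable_EFinP; exact/(measurable_restrictT _ _).1.
Qed.

Section Lq_lemmas.
Context {R : realType}.
Notation mu := (@lebesgue_measure R).
Variables (D : set R) (q : R).
Hypotheses (mD : measurable D) (q1 : 1 <= q).
Implicit Types w v : R -> R.

Let q0 : 0 < q. Proof. exact: lt_le_trans ltr01 q1. Qed.

Lemma Lq_normE w :
  Lq_norm D q w = ((\int[mu]_(x in D) (`|w x| `^ q)%:E) `^ q^-1)%E.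
Proof.
rewrite /Lq_norm unlock /=; congr (_ `^ _)%E; rewrite [RHS]integral_mkcond.
apply: eq_integral => x _; rewrite /= !patchE; case: ifP => // _.
by rewrite normr0 powR0// gt_eqF.
Qed.

Let measurable_normr_powR w : measurable_fun D w ->
  measurable_fun D (fun x => (`|w x| `^ q)%:E).
Proof.
move=> mw; apply/measurable_EFinP.
have mabs : measurable_fun D (fun x => `|w x|) by exact: measurableT_comp.
exact: measurableT_comp (measurable_powR q) mabs.
Qed.

Lemma ae_eq_Lq_norm v w : measurable_fun D v -> measurable_fun D w ->
  {ae mu, forall x, v x = w x} -> Lq_norm D q v = Lq_norm D q w.
Proof.
move=> mv mw vw; rewrite !Lq_normE; congr (_ `^ _)%E.
apply: ge0_ae_eq_integral => //; try exact: measurable_normr_powR.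
move: vw; apply: filterS; first exact: (ae_filter_ringOfSetsType mu).
by move=> x -> _.
Qed.

(** [|w|^q <= M^(q - 1) * |w|] when [|w| <= M]. *)
Lemma Lq_norm_le_L1 w (M I : R) : measurable_fun D w -> 0 <= M -> 0 <= I ->
  (forall x, D x -> `|w x| <= M) ->
  (\int[mu]_(x in D) `|w x|%:E <= I%:E)%E ->
  (Lq_norm D q w <= ((M `^ (q - 1) * I) `^ q^-1)%:E)%E.
Proof.
move=> mw M0 I0 wM wI; rewrite Lq_normE -poweR_EFin.
apply: gt0_ler_poweR.
- by rewrite invr_ge0 ltW.
- rewrite in_itv/= leey andbT; apply: integral_ge0 => x _.
  by rewrite lee_fin powR_ge0.
- by rewrite in_itv/= leey andbT lee_fin mulr_ge0// powR_ge0.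
have mabs : measurable_fun D (fun x => `|w x|%:E).
  by apply/measurable_EFinP; exact: measurableT_comp.
apply: (@le_trans _ _ (\int[mu]_(x in D) ((M `^ (q - 1))%:E * `|w x|%:E))%E).
  apply: ge0_le_integral => //.
  - exact: measurable_normr_powR.
  - exact: measurable_funeM.
  move=> x Dx; rewrite -EFinM lee_fin.
  have [->|w0] := eqVneq `|w x| 0; first by rewrite powR0 ?mulr0// gt_eqF.
  rewrite -[X in _ `^ X <= _](subrK 1 q) [X in X <= _]powRD ?w0 ?implybT//.
  rewrite powRr1// ler_wpM2r// ge0_ler_powR ?subr_ge0// ?nnegrE//.
  exact: wM.
rewrite ge0_integralZl_EFin// ?powR_ge0//.
by rewrite EFinM lee_wpmul2l// lee_fin powR_ge0.
Qed.

Lemma cvge0P (u : nat -> \bar R) : (forall n, 0 <= u n)%E ->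
  (forall e, 0 < e -> \forall n \near \oo, (u n <= e%:E)%E) ->
  u n @[n --> \oo] --> 0%E.
Proof.
move=> u0 ue; apply/fine_cvgP; split.
  apply: filterS (ue 1 ltr01) => n un.
  by rewrite ge0_fin_numE//; exact: le_lt_trans un (ltry _).
apply/cvgrPdist_le => e e0; apply: filterS (ue e e0) => n un.
rewrite sub0r normrN /= ger0_norm; last exact: fine_ge0.
rewrite -lee_fin fineK// ge0_fin_numE//; exact: le_lt_trans un (ltry _).
Qed.

Lemma in_Lq_bounded w M : (mu D < +oo)%E -> measurable_fun D w ->
  (forall x, D x -> `|w x| <= M) -> in_Lq D q w.
Proof.
move=> Dfin mw wM; split => //.
pose K := Num.max 0 M; have K0 : 0 <= K by rewrite le_max lexx.
have wK x : D x -> `|w x| <= K by move=> /wM wx; rewrite le_max wx orbT.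
have Dfn : mu D \is a fin_num by rewrite ge0_fin_numE.
have I0 : 0 <= K * fine (mu D) by rewrite mulr_ge0// fine_ge0.
apply: le_lt_trans (Lq_norm_le_L1 mw K0 I0 wK _) (ltry _).
rewrite EFinM fineK// -integral_cst//; apply: ge0_le_integral => //.
by apply/measurable_EFinP; exact: measurableT_comp.
Qed.

(** On a set of finite measure, uniformly bounded functions that converge in L^1
    converge in every L^q. *)
Lemma Lq_cvg_bounded (wn : nat -> R -> R) w M : (mu D < +oo)%E ->
  (forall n, measurable_fun D (wn n)) -> measurable_fun D w ->
  (forall n x, D x -> `|wn n x| <= M) -> (forall x, D x -> `|w x| <= M) ->
  (forall e, 0 < e -> \forall n \near \oo,
     (\int[mu]_(x in D) `|wn n x - w x|%:E <= e%:E)%E) ->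
  Lq_cvg D q wn w.
Proof.
move=> Dfin mwn mw wnM wM cv; split.
- by move=> n; exact: in_Lq_bounded (wnM n).
- exact: in_Lq_bounded wM.
pose K := `|M| + `|M| + 1.
have K0 : 0 < K by rewrite ltr_wpDl// addr_ge0.
apply: cvge0P => [n|e e0].
  by rewrite Lnorm_ge0.
(* This L^1 distance makes the bound of [Lq_norm_le_L1] equal to [e]. *)
have I0 : 0 < e `^ q / K `^ (q - 1) by rewrite divr_gt0// powR_gt0.
apply: filterS (cv _ I0) => n cvn.
have mB : measurable_fun D (wn n \- w) by exact: measurable_funB.
have wK x : D x -> `|(wn n \- w) x| <= K.
  move=> Dx; apply: (le_trans (ler_normB _ _)); rewrite /K.
  have := wnM n x Dx; have := wM x Dx; have := ler_norm M; lra.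
apply: le_trans (Lq_norm_le_L1 mB (ltW K0) (ltW I0) wK cvn) _.
rewrite mulrC divfK ?gt_eqF ?powR_gt0// -powRrM mulfV ?gt_eqF//.
by rewrite powRr1// ltW.
Qed.

Lemma Lq_cvg_ae (vn wn : nat -> R -> R) v w :
  (forall n, measurable_fun D (vn n)) -> measurable_fun D v ->
  (forall n, {ae mu, forall x, vn n x = wn n x}) ->
  {ae mu, forall x, v x = w x} -> Lq_cvg D q wn w -> Lq_cvg D q vn v.
Proof.
move=> mvn mv vwn vw [wnq [mw wq] cv]; split.
- move=> n; have [mwn wnoo] := wnq n.
  by split => //; rewrite (ae_eq_Lq_norm (mvn n) mwn (vwn n)).
- by split => //; rewrite (ae_eq_Lq_norm mv mw vw).
suff -> : (fun n => Lq_norm D q (vn n \- v)) =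
    (fun n => Lq_norm D q (wn n \- w)) by [].
apply/funext => n; have [mwn _] := wnq n.
apply: ae_eq_Lq_norm; try exact: measurable_funB.
move: (vwn n) vw; apply: filterS2; first exact: (ae_filter_ringOfSetsType mu).
by move=> x /= -> ->.
Qed.

Lemma L1_cvg_dist (gn : nat -> R -> R) g : Lq_cvg D 1 gn g ->
  exists2 dlt : nat -> R, dlt n @[n --> \oo] --> 0 &
    forall n, (\int[mu]_x `|(g \_ D) x - (gn n \_ D) x|%:E <= (dlt n)%:E)%E.
Proof.
move=> [gnL gL cv]; exists (fun n => fine (Lq_norm D 1 (gn n \- g))).
  exact: fine_cvg cv.
move=> n.
have -> : (\int[mu]_x `|(g \_ D) x - (gn n \_ D) x|%:E =
    Lq_norm D 1%R (gn n \- g)%R)%E.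
  rewrite /Lq_norm Lnorm1; apply: eq_integral => x _; rewrite /= !patchE.
  by case: ifP => _; rewrite ?subrr ?normr0// distrC.
rewrite fineK// ge0_fin_numE ?Lnorm_ge0// /Lq_norm Lnorm1.
have ign := in_L1_integrable mD (gnL n); have ig := in_L1_integrable mD gL.
have /integrableP[_] := integrableB measurableT ign ig.
apply: le_lt_trans; rewrite le_eqVlt; apply/orP; left; apply/eqP.
apply: eq_integral => x _; rewrite /= !patchE.
by case: ifP => _ //=; rewrite subrr.
Qed.

End Lq_lemmas.

(** * The slope of a reparametrized curve *)

Section metric_speed.
Context {R : realType} {X : metricType R}.
Notation mu := (@lebesgue_measure R).

Variables (a b eps : R) (f : R -> X).
Hypotheses (ab : a < b) (eps0 : 0 < eps).
Hypothesis f1 : in_Lq `]a, b[ 1 (metric_slope f).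
Let g := metric_slope f \_ `]a, b[.

Lemma is_speed_metric_slope : is_speed a b eps g.
Proof.
split => //; first exact: in_L1_integrable.
by move=> x; rewrite /g patchE; case: ifP => // _; exact: metric_slope_ge0.
Qed.
Let gP := is_speed_metric_slope.

Lemma arc_sE x : x <= b -> arc_s a b eps f x = arclength a eps g x.
Proof.
move=> xb; apply: eq_Rintegral => u; rewrite inE/= in_itv/= => /andP[au ux].
by rewrite /g patchE mem_set//= in_itv/= au (lt_le_trans ux).
Qed.

(** The partial inverse that defines [arc_t] on [0, L] is a true inverse because
    the arc length maps [a, b] onto [0, L]. *)
Lemma is_inv_arclength_arc_t : is_inv_arclength a b eps g (arc_t a b eps f).
Proof.
have L0 := arclength_b_gt0 gP.
have sf : set_surj `[a, b] `[0, arclength a eps g b] (arc_s a b eps f).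
  move=> y /(arclength_surj gP)[x /= xab <-]; exists x => //.
  by rewrite arc_sE//; move: xab; rewrite in_itv/= => /andP[].
have key y : a <= arc_t a b eps f y <= b /\
  arclength a eps g (arc_t a b eps f y) =
        Num.max 0 (Num.min y (arclength a eps g b)).
  rewrite /arc_t arc_sE//; have [y0|y0] := ltP y 0.
    rewrite lexx ltW// arclength_a; split => //.
    by rewrite max_l// ge_min ltW.
  have [yL|yL] := ltP; first by rewrite max_r ?lexx ?(ltW ab) ?(ltW L0).
  have yin : `[0, arclength a eps g b]%classic y by rewrite /= in_itv/= y0.
  rewrite max_r//; set x := 'pinv_ _ _ _ _.
  have xab : a <= x <= b.
    have : `[a, b]%classic x by apply: (surjpinv_image_sub sf); exists y.
    by rewrite /= in_itv.
  split => //; have /andP[_ xb] := xab; rewrite -arc_sE//.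
  by rewrite /x pinvK// inE; exact: sf.
by split => [//|y|y]; case: (key y).
Qed.

End metric_speed.

Section absolutely_continuous_curves.
Context {R : realType} {X : metricType R}.
Notation mu := (@lebesgue_measure R).

(** The primitive of the bound [m] is continuous. *)
Lemma AC1_continuous a b (f : R -> X) : AC1 a b f ->
  forall x, a < x < b -> {for x, continuous f}.
Proof.
move=> [m im fm] x /andP[ax xb]; have ab := lt_trans ax xb.
pose m' := m \_ `]a, b[.
have im' : mu.-integrable [set: R] (EFin \o m').
  by rewrite -restrict_EFin; apply/(integrable_mkcond _ _).1.
have imI (I : interval R) : mu.-integrable [set` I] (EFin \o m').
  exact: integrableS im'.
pose P y := \int[mu]_(u in `[a, y]) m' u.
have Pcont : {within `[a, b], continuous P}.
  by apply: parameterized_integral_continuous; [exact: ltW|exact: imI].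
have PB y z : a < y -> y <= z -> z < b -> mdist (f y) (f z) <= `|P y - P z|.
  move=> ay yz zb; apply: le_trans (fm _ _ ay yz zb) _.
  rewrite distrC; apply: le_trans (ler_norm _); rewrite /P.
  rewrite Rintegral_itvB ?bnd_simp//; last exact: ltW.
  rewrite Rintegral_itv_obnd_cbnd; last exact: imI.
  rewrite le_eqVlt; apply/orP; left; apply/eqP/eq_Rintegral => u.
  rewrite inE/= in_itv/= => /andP[yu uz].
  by rewrite /m' patchE mem_set//= in_itv/= (lt_le_trans ay)//= (le_lt_trans uz).
have Px : {for x, continuous P}.
  by apply: within_continuous_continuous ab Pcont _; rewrite in_itv/= ax.
apply/metricType_numDomainType.cvgrPdist_le => e e0.
near=> z.
have zab : a < z < b.
  have : z \in `]a, b[.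
    by near: z; apply: near_in_itvoo; rewrite in_itv/= ax.
  by rewrite in_itv.
have /andP[az zb] := zab.
apply: (@le_trans _ _ `|P x - P z|).
  have [xz|/ltW zx] := leP x z; first exact: PB.
  by rewrite metric_sym distrC; exact: PB.
by near: z; apply: cvgr_dist_le.
Unshelve. all: by end_near. Qed.

End absolutely_continuous_curves.

Section reparam_slope.
Context {R : realType} {X : metricType R}.
Notation mu := (@lebesgue_measure R).
Variables (a b eps : R) (f : R -> X).
Hypotheses (ab : a < b) (eps0 : 0 < eps) (ACf : AC1 a b f).
Hypothesis f1 : in_Lq `]a, b[ 1 (metric_slope f).
Let g := metric_slope f \_ `]a, b[.
Let t := arc_t a b eps f.
Let s := arclength a eps g.
Let L := s b.
Let F := reparam a b eps f.
Let tP : is_inv_arclength a b eps g t.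
Proof. exact: is_inv_arclength_arc_t. Qed.
Let gP : is_speed a b eps g. Proof. by case: tP. Qed.
Let L0 : 0 < L. Proof. exact: arclength_b_gt0 gP. Qed.

Let t_oo y : 0 < y < L -> a < t y < b.
Proof.
move=> /andP[y0 yL]; have [_ /(_ y)/andP[aty tyb] _] := tP.
have sty : s (t y) = y by rewrite /s (arclength_inv_in tP) ?ltW.
have sa : s a = 0 by exact: arclength_a.
rewrite -(ltr_arclength gP)// -/s sty sa y0/=.
by rewrite -(ltr_arclength gP) ?(ltW ab)// -/s sty.
Qed.

Let near_oo y : 0 < y < L -> \forall z \near y, 0 < z < L.
Proof.
move=> yL; have /near_in_itvoo : y \in `]0, L[ by rewrite in_itv.
by apply: filterS => z; rewrite in_itv.
Qed.

Lemma near_reparam y : 0 < y < L -> \forall z \near y, F z = (f \o t) z.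
Proof.
move=> /near_oo; apply: filterS => z /t_oo/andP[az zb].
by rewrite /F /reparam /= /cont_ext -/t leNgt az/= leNgt zb.
Qed.

Lemma metric_slope_reparam_lt0 y : y < 0 -> metric_slope F y = 0.
Proof.
move=> y0; apply: (@metric_slope_const _ _ _ (cont_ext a b f a)).
near=> z; rewrite /F /reparam /= /arc_t.
by have -> : z < 0 by near: z; exact: lt_nbhsl.
Unshelve. all: by end_near. Qed.

Lemma metric_slope_reparam_gt y : L < y -> metric_slope F y = 0.
Proof.
move=> yL; apply: (@metric_slope_const _ _ _ (cont_ext a b f b)).
near=> z; rewrite /F /reparam /= /arc_t.
have zL : L < z by near: z; exact: lt_nbhsr.
by rewrite ltNge (ltW (lt_trans L0 zL))/= arc_sE// -/g -/s -/L zL.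
Unshelve. all: by end_near. Qed.

(** The line is cut at [0] and [L]: the curve is constant on the two outer
    half-lines and, in between, continuous. *)
Lemma measurable_metric_slope_reparam :
  measurable_fun [set: R] (metric_slope F).
Proof.
have m0 : measurable_fun (`]-oo, 0[%classic : set R) (metric_slope F).
  apply: (@eq_measurable_fun _ _ _ _ _ (cst (0 : R))) => //.
  by move=> y; rewrite inE/= in_itv/= => /metric_slope_reparam_lt0.
have mL : measurable_fun (`]L, +oo[%classic : set R) (metric_slope F).
  apply: (@eq_measurable_fun _ _ _ _ _ (cst (0 : R))) => //.
  by move=> y; rewrite inE/= in_itv/= andbT => /metric_slope_reparam_gt.
have m0L : measurable_fun (`]0, L[%classic : set R) (metric_slope F).
  apply: measurable_metric_slope_itv => y yL.
  apply: (near_eq_continuous_for (phi := f \o t)).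
    by apply: filterS (near_reparam yL) => z ->.
  apply: continuous_comp; first exact: continuous_inv_arclength tP y.
  exact: AC1_continuous ACf _ (t_oo yL).
have mU (A B : set R) : measurable A -> measurable B ->
    measurable_fun A (metric_slope F) -> measurable_fun B (metric_slope F) ->
    measurable_fun (A `|` B) (metric_slope F).
  by move=> mA mB fA fB; apply/measurable_funU.
rewrite (_ : [set: R] = `]-oo, 0[ `|` [set 0] `|` `]0, L[ `|` [set L] `|`
    `]L, +oo[).
  apply: (mU) => //; first by do ! apply: measurableU.
  apply: (mU) => //; [by do ! apply: measurableU| |exact: measurable_fun_set1].
  apply: (mU) => //; first exact: measurableU.
  by apply: (mU) => //; exact: measurable_fun_set1.
apply/seteqP; split => // y _ /=; rewrite !in_itv/= andbT.
have [y0|y0|y0] := ltgtP y 0; [by do 4 left| |by do 3 left; right].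
by have [yL|yL|yL] := ltgtP y L; [do 2 left; right|right|left; right].
Qed.

(** On ]0, L[ the chain rule gives the slope [g (t y) / (eps + g (t y))], written
    here as [1 - eps / (eps + g (t y))] to express it through [inv_speed]. *)
Lemma ae_metric_slope_reparam : {ae mu, forall y,
  metric_slope F y = \1_`]0, L] y - eps * inv_speed a b eps g t y}.
Proof.
have n0 : {ae mu, forall y, y <> 0}.
  exists [set 0]; split => //; first exact: lebesgue_measure_set1.
  by move=> y /= /contrapT.
have nL : {ae mu, forall y, y <> L}.
  exists [set L]; split => //; first exact: lebesgue_measure_set1.
  by move=> y /= /contrapT.
have := ae_is_derive_arclength tP.
move: n0 nL; apply: filterS3; first exact: (ae_filter_ringOfSetsType mu).
move=> y /eqP y0 /eqP yL ds.
rewrite /inv_speed indicE mem_setE in_itv/=.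
have [ylt0|ygt0|/eqP] := ltgtP y 0; last by rewrite (negbTE y0).
  by rewrite metric_slope_reparam_lt0// !mulr0 subr0.
have [yltL|yL'|/eqP] := ltgtP y L; last by rewrite (negbTE yL).
- have y0L : 0 < y < L by rewrite ygt0.
  rewrite mulr1 (near_eq_metric_slope (near_reparam y0L)).
  have sK : \forall z \near y, s (t z) = z.
    apply: filterS (near_oo y0L) => z /andP[z0 zL].
    by rewrite /s (arclength_inv_in tP) ?ltW.
  have tK : \forall u \near t y, t (s u) = u.
    have /near_in_itvoo : t y \in `]a, b[ by rewrite in_itv; exact: t_oo.
    apply: filterS => u; rewrite in_itv/= => /andP[au ub].
    by rewrite /s (arclengthK tP) ?ltW.
  rewrite (metric_slope_comp f (speed_gt0 gP (t y)) (erefl _)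
    (nbhs_singleton sK) (ds y0L) _ sK tK); last first.
    exact: continuous_inv_arclength tP y.
  have -> : metric_slope f (t y) = g (t y).
    by rewrite /g patchE mem_set//= in_itv; exact: t_oo.
  have := speed_gt0 gP (t y); move: (g (t y)) => v v0 /=; field.
  by rewrite gt_eqF.
- by rewrite metric_slope_reparam_gt// !mulr0 subr0.
Qed.

End reparam_slope.

(** * Weak derivatives *)

Section weak_derivatives.
Context {R : realType}.
Notation mu := (@lebesgue_measure R).

(** Such a function has derivative [0] everywhere. Clamping the variable extends
    the hypothesis from [c, d] to the whole line. *)
Lemma quadratic_oscillation_const (Phi : R -> R) (c d C : R) : c <= d -> 0 <= C ->
  (forall y z, c <= y -> y <= z -> z <= d ->
    `|Phi z - Phi y| <= C * (z - y) ^+ 2) ->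
  Phi d = Phi c.
Proof.
move=> cd C0 PhiC; pose cl y := Num.max c (Num.min y d).
pose Psi := Phi \o cl.
have PsiC y z : `|Psi z - Psi y| <= C * (z - y) ^+ 2.
  wlog yz : y z / y <= z => [hw|].
    by case/orP: (le_total y z) => /hw//; rewrite distrC -(opprB z y) sqrrN.
  have cly : c <= cl y by rewrite le_max lexx.
  have clz : cl z <= d by rewrite ge_max cd ge_min lexx orbT.
  have [clyz clyz'] : cl y <= cl z /\ cl z - cl y <= z - y.
    rewrite /cl /Num.max /Num.min.
    by split; do ! case: ifPn; rewrite -?leNgt => *; lra.
  apply: (le_trans (PhiC _ _ cly clyz clz)); rewrite ler_wpM2l//.
  by rewrite ler_sqr// nnegrE subr_ge0.
have dPsi x : is_derive x (1 : R) Psi 0.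
  apply/is_derive1_caratheodory.
  exists (fun z => (Psi z - Psi x) / (z - x)); split.
  - move=> z; have [->|zx] := eqVneq z x; first by rewrite !subrr mulr0.
    by rewrite divfK// subr_eq0.
  - rewrite /prop_for /continuous_at subrr mul0r.
    apply/cvgrPdist_le => e e0; near=> z.
    rewrite sub0r normrN normrM normfV.
    have [->|zx] := eqVneq z x; first by rewrite !subrr normr0 mul0r ltW.
    rewrite ler_pdivrMr ?normr_gt0 ?subr_eq0//.
    apply: (le_trans (PsiC _ _)); rewrite -real_normK ?num_real// expr2 mulrA.
    rewrite ler_wpM2r//.
    have : `|x - z| <= e / (C + 1).
      near: z; apply: cvgr_dist_le; first exact: cvg_id.
      by rewrite divr_gt0// ltr_wpDl.
    rewrite ler_pdivlMr ?ltr_wpDl// distrC => h; apply: le_trans h.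
    by rewrite mulrC ler_wpM2l// lerDl.
  - by rewrite subrr mul0r.
have := is_derive_0_is_cst d c dPsi.
by rewrite /Psi /= /cl min_r// max_r// min_l// max_l.
Unshelve. all: by end_near. Qed.

(** Integration by parts for [u], the primitive of a merely bounded [v], against a
    smooth [phi]. The product [u * phi] need not be differentiable everywhere.
    Consider [Phi y = u y * phi y - int_c^y (v * phi + u * phi')]. Its increment
    from [y] to [z] is
      [int_y^z (v x * (phi z - phi x) + (u y - u x) * phi' x) dx],
    which is of order [(z - y) ^ 2] because [u] and [phi] are Lipschitz. So [Phi]
    is constant, and it remains to evaluate it at [c] and [d], where [phi]
    vanishes. *)
Lemma lipschitz_primitive_weak_derivative (c d M : R) (u v : R -> R) :
  c < d -> measurable_fun [set: R] v -> (forall y, `|v y| <= M) ->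
  (forall y z, `|u y - u z| <= M * `|y - z|) ->
  (forall y z, y <= z -> (\int[mu]_(x in `]y, z]) (v x)%:E = (u z - u y)%:E)%E) ->
  weak_derivative `]c, d[ u v.
Proof.
move=> cd mv vM uM uv.
have M0 : 0 <= M := le_trans (normr_ge0 _) (vM 0).
have ucont : continuous u.
  move=> y; apply/cvgrPdist_le => e e0; near=> z.
  apply: (le_trans (uM _ _)).
  have : `|y - z| <= e / (M + 1).
    near: z; apply: cvgr_dist_le; first exact: cvg_id.
    by rewrite divr_gt0// ltr_wpDl.
  rewrite ler_pdivlMr ?ltr_wpDl// => h; apply: le_trans h.
  by rewrite mulrC ler_wpM2l// lerDl.
have mu' : measurable_fun [set: R] u by exact: continuous_measurable_fun.
have finI (b1 b2 : bool) y z :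
    (mu [set` Interval (BSide b1 y) (BSide b2 z)] < +oo)%E.
  by rewrite lebesgue_measure_itv/=; case: ifP => // _; rewrite -EFinB ltry.
have bint (b1 b2 : bool) y z (w : R -> R) K : measurable_fun [set: R] w ->
    (forall x, y <= x <= z -> `|w x| <= K) ->
    mu.-integrable [set` Interval (BSide b1 y) (BSide b2 z)] (EFin \o w).
  move=> mw wK; apply: measurable_bounded_integrable => //.
  - exact: finI.
  - exact: measurable_funTS.
  exists K; split; first exact: num_real.
  move=> k Kk x /= xyz; apply: le_trans (ltW Kk); apply: wK.
  by move: xyz; rewrite in_itv => /andP[/lteifW -> /lteifW ->].
split.
- apply: open_integrable_locally; first exact: interval_open.
  have [K _ uK] := continuous_bounded_itv c d ucont.
  exact: bint uK.
- apply: open_integrable_locally; first exact: interval_open.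
  by apply: (bint _ _ _ _ _ M) => // x _.
move=> phi [smooth csupp suppcd].
have phi_out x : ~ `]c, d[%classic x -> phi x = 0.
  move=> xcd; apply: contra_notP xcd => /eqP phix.
  by apply: suppcd; exact: subset_closure.
have phic : phi c = 0 by apply: phi_out; rewrite /= in_itv/= ltxx.
have phid : phi d = 0 by apply: phi_out; rewrite /= in_itv/= ltxx andbF.
pose phi' := phi^`()%classic.
have dphi x : is_derive x (1 : R) phi (phi' x).
  by rewrite /phi' derive1E; apply: derivableP; exact: (smooth 0%N).
have phicont : continuous phi.
  move=> x; apply: differentiable_continuous; apply/derivable1_diffP.
  exact: (smooth 0%N).
have phi'cont : continuous phi'.
  move=> x; apply: differentiable_continuous; apply/derivable1_diffP.
  by have := smooth 1%N x; rewrite derive1n1.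
have mphi : measurable_fun [set: R] phi by exact: continuous_measurable_fun.
have mphi' : measurable_fun [set: R] phi' by exact: continuous_measurable_fun.
have [U U0 uU] := continuous_bounded_itv c d ucont.
have [P P0 phiP] := continuous_bounded_itv c d phicont.
have [K K0 phi'K] := continuous_bounded_itv c d phi'cont.
have ivphi (b1 b2 : bool) y z : c <= y -> z <= d ->
    mu.-integrable [set` Interval (BSide b1 y) (BSide b2 z)]
      (EFin \o (fun x => v x * phi x)).
  move=> cy zd; apply: (bint _ _ _ _ _ (M * P)); first exact: measurable_funM.
  move=> x /andP[yx xz]; rewrite normrM ler_pM// phiP//.
  by rewrite (le_trans cy)//= (le_trans xz).
have iuphi' (b1 b2 : bool) y z : c <= y -> z <= d ->
    mu.-integrable [set` Interval (BSide b1 y) (BSide b2 z)]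
      (EFin \o (fun x => u x * phi' x)).
  move=> cy zd; apply: (bint _ _ _ _ _ (U * K)); first exact: measurable_funM.
  move=> x /andP[yx xz]; rewrite normrM.
  have xcd : c <= x <= d by rewrite (le_trans cy)//= (le_trans xz).
  by rewrite ler_pM// ?uU ?phi'K.
pose W x := v x * phi x + u x * phi' x.
have iW (b1 b2 : bool) y z : c <= y -> z <= d ->
    mu.-integrable [set` Interval (BSide b1 y) (BSide b2 z)] (EFin \o W).
  move=> cy zd.
  by have := integrableD _ (ivphi b1 b2 _ _ cy zd) (iuphi' b1 b2 _ _ cy zd); apply.
have phiB y z : c <= y -> y <= z -> z <= d ->
    \int[mu]_(x in `]y, z]) phi' x = phi z - phi y.
  move=> cy; rewrite le_eqVlt => /predU1P[<- _|yz zd].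
    by rewrite set_itvoc0 Rintegral_set0 subrr.
  rewrite Rintegral_itv_obnd_cbnd; last first.
    apply: (bint _ _ _ _ _ K) => // x /andP[yx xz].
    by rewrite phi'K// (le_trans cy)//= (le_trans xz).
  rewrite /Rintegral (continuous_FTC2 (F := phi) yz)//.
  - exact: continuous_subspaceT.
  - split=> [x _||]; first exact: (smooth 0%N).
    + exact: cvg_at_right_filter (phicont y).
    + exact: cvg_at_left_filter (phicont z).
pose Phi y := u y * phi y - \int[mu]_(x in `]c, y]) W x.
have PhiC y z : c <= y -> y <= z -> z <= d ->
    `|Phi z - Phi y| <= (2 * M * K) * (z - y) ^+ 2.
  move=> cy yz zd.
  have incd x : y <= x <= z -> c <= x <= d.
    by move=> /andP[yx xz]; rewrite (le_trans cy)//= (le_trans xz).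
  pose E x := v x * (phi z - phi x) + (u y - u x) * phi' x.
  have iv : mu.-integrable `]y, z] (EFin \o v).
    by apply: (bint _ _ _ _ _ M) => // x _.
  have iphi' : mu.-integrable `]y, z] (EFin \o phi').
    by apply: (bint _ _ _ _ _ K) => // x /incd; exact: phi'K.
  have ivz : mu.-integrable `]y, z] (EFin \o (fun x => v x * phi z)).
    by have := integrableZr _ (phi z) iv; apply.
  have iuy : mu.-integrable `]y, z] (EFin \o (fun x => u y * phi' x)).
    by have := integrableZl _ (u y) iphi'; apply.
  have iA : mu.-integrable `]y, z] (EFin \o (fun x => v x * phi z + u y * phi' x)).
    by have := integrableD _ ivz iuy; apply.
  have iWyz := iW false false _ _ cy zd.
  have PhiE : Phi z - Phi y = \int[mu]_(x in `]y, z]) E x.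
    rewrite (@eq_Rintegral _ _ _ mu _ (fun x => v x * phi z + u y * phi' x - W x)).
      rewrite RintegralB// RintegralD// RintegralZr// RintegralZl// phiB//.
      rewrite (_ : \int[mu]_(x in `]y, z]) v x = u z - u y); last first.
        by rewrite /Rintegral uv.
      have <- : \int[mu]_(x in `]c, z]) W x - \int[mu]_(x in `]c, y]) W x =
          \int[mu]_(x in `]y, z]) W x.
        by rewrite Rintegral_itvB// ?bnd_simp//; exact: iW.
      by rewrite /Phi; ring.
    by move=> x _; rewrite /E /W; ring.
  have iE : mu.-integrable `]y, z] (EFin \o E).
    have := integrableB _ iA iWyz; move=> /(_ (measurable_itv _)).
    by apply: eq_integrable => // x _; rewrite /= -EFinB /E /W; congr (_%:E); ring.
  rewrite PhiE; apply: (le_trans (le_normr_Rintegral _ iE)) => //.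
  have zy0 : 0 <= z - y by rewrite subr_ge0.
  apply: (@le_trans _ _ (\int[mu]_(x in `]y, z]) (2 * M * K * (z - y)))).
    apply: le_Rintegral => //.
    - exact: integrable_norm.
    - by apply: (bint _ _ _ _ _ `|2 * M * K * (z - y)|).
    move=> x /=; rewrite in_itv/= => /andP[/ltW yx xz].
    have Ex : y <= x <= z by rewrite yx.
    have phizx : `|phi z - phi x| <= K * (z - y).
      have [w] := MVT_segment xz (fun x' _ => dphi x')
        (continuous_subspaceT phicont).
      rewrite in_itv/= => /andP[xw wz] ->; rewrite normrM.
      rewrite ler_pM// ?phi'K ?incd ?(le_trans yx)//.
      by rewrite ger0_norm ?subr_ge0// lerD2l lerN2.
    have uyx : `|u y - u x| <= M * (z - y).
      apply: (le_trans (uM _ _)); rewrite ler_wpM2l// distrC.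
      by rewrite ger0_norm ?subr_ge0// lerD2r.
    apply: (le_trans (ler_normD _ _)); rewrite !normrM.
    have -> : 2 * M * K * (z - y) = M * (K * (z - y)) + M * (z - y) * K by ring.
    by rewrite lerD// ler_pM// ?phi'K ?incd.
  rewrite Rintegral_cst// [X in fine X](lebesgue_measure_itv `]y, z])/= lte_fin.
  case: ifPn => [_|]; first by rewrite /= expr2 mulrA.
  by rewrite /= mulr0 => _; rewrite !mulr_ge0// exprn_even_ge0.
have := quadratic_oscillation_const (ltW cd) _ PhiC.
rewrite /Phi phic phid !mulr0 !sub0r set_itvoc0 Rintegral_set0 oppr0.
rewrite !mulr_ge0// => /(_ isT) /eqP; rewrite oppr_eq0 => /eqP.
rewrite -Rintegral_itv_bndo_bndc; last exact: iW.
rewrite RintegralD//; [|exact: ivphi|exact: iuphi'] => /eqP.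
by rewrite addr_eq0 => /eqP ->; rewrite opprK.
Unshelve. all: by end_near. Qed.

End weak_derivatives.

(** * Convergence on bounded intervals *)

Section inverse_convergence.
Context {R : realType}.
Notation mu := (@lebesgue_measure R).
Variables (a b eps q c d : R) (g t : R -> R) (gn tn : nat -> R -> R).
Variable dlt : nat -> R.
Hypotheses (q1 : 1 <= q) (cd : c < d).
Hypotheses (tP : is_inv_arclength a b eps g t)
  (tnP : forall n, is_inv_arclength a b eps (gn n) (tn n)).
Hypothesis g_gn : forall n,
  (\int[mu]_x `|g x - gn n x|%:E <= (dlt n)%:E)%E.
Hypothesis dlt0 : dlt n @[n --> \oo] --> 0.
Let L := arclength a eps g b.
Let Ln n := arclength a eps (gn n) b.
Let k := inv_speed a b eps g t.
Let kn n := inv_speed a b eps (gn n) (tn n).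

Let eps0 : 0 < eps. Proof. by case: tP => -[]. Qed.
Let mk : measurable_fun [set: R] k.
Proof. exact: measurable_inv_speed tP. Qed.
Let mkn n : measurable_fun [set: R] (kn n).
Proof. exact: measurable_inv_speed (tnP n). Qed.
Let kV y : `|k y| <= eps^-1.
Proof.
by rewrite ger0_norm; [exact: inv_speed_le tP y|exact: inv_speed_ge0 tP y].
Qed.
Let knV n y : `|kn n y| <= eps^-1.
Proof.
rewrite ger0_norm; first exact: inv_speed_le (tnP n) y.
exact: inv_speed_ge0 (tnP n) y.
Qed.

Let D : set R := `]c, d[%classic.
Let mD : measurable D. Proof. exact: measurable_itv. Qed.
Let Dfin : (mu D < +oo)%E.
Proof. by rewrite lebesgue_measure_itv/= lte_fin cd -EFinB ltry. Qed.

Lemma Lq_cvg_inv_arclength : Lq_cvg D q tn t.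
Proof.
have mt := measurable_inv_arclength tP.
have mtn n := measurable_inv_arclength (tnP n).
have tb u : a <= u <= b -> `|u| <= `|a| + `|b|.
  move=> /andP[au ub]; rewrite ler_norml; apply/andP; split.
    have := ler_norm (- a); rewrite normrN; have := normr_ge0 b; lra.
  have := ler_norm b; have := normr_ge0 a; lra.
apply: (@Lq_cvg_bounded _ D q mD q1 tn t (`|a| + `|b|) Dfin).
- by move=> n; exact: (measurable_funTS (mtn n)).
- exact: (measurable_funTS mt).
- by move=> n x _; apply: tb; case: (tnP n) => _ + _; exact.
- by move=> x _; apply: tb; case: tP => _ + _; exact.
move=> e e0; near=> n.
apply: (@le_trans _ _ (\int[mu]_(x in D) cst (2 * dlt n / eps)%:E x)%E).
  apply: ge0_le_integral => //.
  - apply/measurable_EFinP; apply: measurable_funTS.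
    by apply: measurableT_comp => //; exact: measurable_funB (mtn n) mt.
  move=> x _; rewrite /= lee_fin distrC.
  exact: inv_arclength_dist tP (tnP n) (g_gn n) x.
rewrite integral_cst// [X in (_ * X)%E](lebesgue_measure_itv `]c, d[)/=.
rewrite lte_fin cd -EFinB -EFinM lee_fin.
have : `|dlt n| <= e * eps / (2 * (d - c)).
  near: n; apply: cvgr0_norm_le => //.
  by rewrite divr_gt0 ?mulr_gt0// subr_gt0.
have dc0 : 0 < d - c by rewrite subr_gt0.
move=> /(le_trans (ler_norm _)); rewrite ler_pdivlMr ?mulr_gt0// => h.
rewrite mulrAC ler_pdivrMr//; apply: le_trans h.
by rewrite [leLHS](_ : _ = dlt n * (2 * (d - c)))//; ring.
Unshelve. all: by end_near. Qed.

Lemma cvg_integral_inv_speed e : 0 < e ->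
  \forall n \near \oo, (\int[mu]_(x in D) `|kn n x - k x|%:E <= e%:E)%E.
Proof.
move=> e0; apply: filterS (cvg_inv_speed tP tnP g_gn dlt0 e0) => n.
apply: le_trans.
under eq_integral do rewrite distrC.
apply: ge0_subset_integral => //; apply/measurable_EFinP.
by apply: measurableT_comp => //; exact: measurable_funB mk (mkn n).
Qed.

Lemma Lq_cvg_inv_speed : Lq_cvg D q kn k.
Proof.
apply: (@Lq_cvg_bounded _ D q mD q1 kn k eps^-1 Dfin).
- by move=> n; exact: (measurable_funTS (mkn n)).
- exact: (measurable_funTS mk).
- by move=> n x _; exact: knV.
- by move=> x _; exact: kV.
exact: cvg_integral_inv_speed.
Qed.

Let w (y : R) : R := \1_(`]0, L]) y - eps * k y.
Let wn n (y : R) : R := \1_(`]0, Ln n]) y - eps * kn n y.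

(** [w] and [wn n] are the slopes of the reparametrized curves, almost
    everywhere. *)
Lemma Lq_cvg_slope_density : Lq_cvg D q wn w.
Proof.
have mw : measurable_fun [set: R] w.
  by apply: measurable_funB; [exact: measurable_indic|exact: measurable_funM].
have mwn n : measurable_fun [set: R] (wn n).
  by apply: measurable_funB; [exact: measurable_indic|exact: measurable_funM].
have bound (A : set R) (y z : R) : `|z| <= eps^-1 -> `|\1_A y - eps * z| <= 2.
  move=> zV; apply: (le_trans (ler_normB _ _)); rewrite -[leRHS]/(1 + 1) lerD//.
    by rewrite indicE; case: (_ \in _); rewrite ?normr1 ?normr0.
  rewrite normrM gtr0_norm// -(mulfV (lt0r_neq0 eps0)).
  by rewrite ler_wpM2l// ltW.
apply: (@Lq_cvg_bounded _ D q mD q1 wn w 2 Dfin).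
- by move=> n; exact: (measurable_funTS (mwn n)).
- exact: (measurable_funTS mw).
- by move=> n x _; exact: bound.
- by move=> x _; exact: bound.
move=> e e0.
have e2 : 0 < e / 2 / eps by rewrite !divr_gt0.
near=> n.
pose E1 u : \bar R := `|\1_(`]0, Ln n]) u - \1_(`]0, L]) u|%:E.
pose E2 u : \bar R := (eps%:E * `|kn n u - k u|%:E)%E.
have mE1 : measurable_fun [set: R] E1.
  apply/measurable_EFinP; apply: measurableT_comp => //.
  by apply: measurable_funB; exact: measurable_indic.
have mkk : measurable_fun [set: R] (fun u => `|kn n u - k u|%:E).
  apply/measurable_EFinP; apply: measurableT_comp => //.
  exact: measurable_funB (mkn n) mk.
have mE2 : measurable_fun [set: R] E2 by exact: measurable_funeM.
apply: (@le_trans _ _ (\int[mu]_(u in D) (E1 u + E2 u))%E).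
  apply: ge0_le_integral => //.
  - apply/measurable_EFinP; apply: measurable_funTS.
    by apply: measurableT_comp => //; exact: measurable_funB (mwn n) mw.
  - apply: emeasurable_funD; first exact: (measurable_funTS mE1).
    exact: (measurable_funTS mE2).
  move=> u _; rewrite /E1 /E2 -EFinM -EFinD lee_fin /wn /w.
  rewrite -[X in _ + X * _](gtr0_norm eps0) -normrM mulrBr.
  rewrite [X in `|X| <= _](_ : _ = (\1_(`]0, Ln n]) u - \1_(`]0, L]) u) -
    (eps * kn n u - eps * k u)); last by ring.
  exact: ler_normB.
rewrite ge0_integralD//; last 4 first.
- by move=> u _; rewrite /E1 lee_fin.
- exact: (measurable_funTS mE1).
- by move=> u _; rewrite /E2 -EFinM lee_fin mulr_ge0// ltW.
- exact: (measurable_funTS mE2).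
rewrite (splitr e) EFinD; apply: leeD.
  apply: (@le_trans _ _ (\int[mu]_u E1 u)%E).
    by apply: ge0_subset_integral => // u _; rewrite /E1 lee_fin.
  apply: (le_trans (integral_indic_itv_dist _ _)); rewrite lee_fin distrC.
  apply: (le_trans (arclength_dist tP (tnP n) (g_gn n) b)).
  apply: (le_trans (ler_norm _)); near: n; apply: cvgr0_norm_le => //.
  by rewrite divr_gt0.
rewrite ge0_integralZl_EFin//; [|exact: (measurable_funTS mkk)|exact: ltW].
rewrite -(divfK (lt0r_neq0 eps0) (e / 2)) mulrC EFinM.
apply: lee_wpmul2l; first by rewrite lee_fin ltW.
by near: n; exact: (cvg_integral_inv_speed e2).
Unshelve. all: by end_near. Qed.

Lemma W1q_cvg_inv_arclength : W1q_cvg D q tn t.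
Proof.
exists kn, k; split.
- move=> n; apply: (lipschitz_primitive_weak_derivative cd (mkn n) (knV n)).
    exact: inv_arclength_lip (tnP n).
  exact: integral_inv_speed (tnP n).
- apply: (lipschitz_primitive_weak_derivative cd mk kV).
    exact: inv_arclength_lip tP.
  exact: integral_inv_speed tP.
- exact: Lq_cvg_inv_arclength.
- exact: Lq_cvg_inv_speed.
Qed.

End inverse_convergence.

Theorem theorem3p7 (R : realType) (X : metricType R) (Xcomplete : is_complete X)
    (a b : R) (ab : a < b) (f : R -> X) (fn : nat -> R -> X)
    (ACf : AC1 a b f) (ACfn : forall n, AC1 a b (fn n))
    (slope_cvg : Lq_cvg `]a, b[ 1 (fun n => metric_slope (fn n)) (metric_slope f))
    (eps : R) (eps_gt0 : 0 < eps) (q : R) (q_ge1 : 1 <= q) :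
  W1q_loc_cvg q (fun n => arc_t a b eps (fn n)) (arc_t a b eps f) /\
  Lq_loc_cvg q (fun n => metric_slope (reparam a b eps (fn n)))
               (metric_slope (reparam a b eps f)).
Proof.
have [fn1 f1 _] := slope_cvg.
have tP := is_inv_arclength_arc_t ab eps_gt0 f1.
have tnP n := is_inv_arclength_arc_t ab eps_gt0 (fn1 n).
have [dlt dlt0 g_gn] := L1_cvg_dist (measurable_itv _) slope_cvg.
split=> c d cd.
  exact: W1q_cvg_inv_arclength cd tP tnP g_gn dlt0.
apply: (Lq_cvg_ae (measurable_itv _) q_ge1 _ _ _ _
  (Lq_cvg_slope_density q_ge1 cd tP tnP g_gn dlt0)).
- move=> n; apply: measurable_funTS.
  exact: (measurable_metric_slope_reparam ab eps_gt0 (ACfn n) (fn1 n)).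
- apply: measurable_funTS.
  exact: (measurable_metric_slope_reparam ab eps_gt0 ACf f1).
- by move=> n; exact: (ae_metric_slope_reparam ab eps_gt0 (fn1 n)).
- exact: (ae_metric_slope_reparam ab eps_gt0 f1).
Qed.
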